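(* Let $n\geqslant 1$ and $k\geqslant 1$ be integers, let $\overline{L}(\xi)=\sum_{i=0}^n b_i\xi^i\in\mathbb{C}[\xi]$ be a polynomial of degree $n$ (so $b_n\neq 0$) such that $\overline{L}(j+k)\neq 0$ for all $j=1,2,\ldots$, and put $$\sigma=\inf_{j\in\mathbb{N},\, j\geqslant 1}\frac{|\overline{L}(j+k)|}{j^n}>0 .$$ Let $M(z,y_0,y_1,\ldots,y_n)$ be a function of $n+2$ complex variables that is holomorphic in a neighbourhood of the closed polydisk $$\overline\Delta=\{|z|\leqslant r,\ |y_0|\leqslant\rho,\ \ldots,\ |y_n|\leqslant\rho\}\subset\mathbb{C}^{n+2},\qquad r,\rho>0,$$ and let $\mu=\max_{\overline\Delta}|M|$. Let $\hat\psi=\sum_{j=1}^{\infty}c_jz^j\in\mathbb{C}[[z]]$ be a formal power series (with $\hat\psi(0)=0$) satisfying the differential equation $$\overline{L}(\delta+k)\hat\psi=z\,M(z,\hat\psi,\delta\hat\psi,\ldots,\delta^n\hat\psi),\qquad \delta=z\frac{d}{dz}.$$ Then the power series $\hat\psi$ converges in the disk $$D_R=\{|z|<R\},\qquad R=r\,\frac{\rho}{\rho+\dfrac{\mu r}{\sigma N}},\qquad N=\frac{(n+1)^{n+1}}{(n+2)^{n+2}} .$$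
   Context: Here $\delta=z\frac{d}{dz}$ acts on formal power series by $\delta\bigl(\sum_j a_jz^j\bigr)=\sum_j j\,a_jz^j$, and $\overline{L}(\delta+k)=\sum_{i=0}^n b_i(\delta+k)^i$, so that $\overline{L}(\delta+k)z^j=\overline{L}(j+k)z^j$. Since $\hat\psi$ and all $\delta^i\hat\psi$ have zero constant term, $M(z,\hat\psi,\delta\hat\psi,\ldots,\delta^n\hat\psi)$ is a well-defined formal power series, obtained by substituting into the Taylor expansion of $M$ at $0\in\mathbb{C}^{n+2}$. *)

(* Defs.v *)
From HB Require Import structures.
From mathcomp Require Import all_boot all_order all_algebra.
From mathcomp Require Import complex.
From mathcomp Require Import all_classical all_reals all_analysis.

Set Implicit Arguments.
Unset Strict Implicit.
Unset Printing Implicit Defensive.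

Import Order.TTheory GRing.Theory Num.Theory numFieldNormedType.Exports.
Local Open Scope classical_set_scope.
Local Open Scope ring_scope.

(* Packaging R[i] as a numClosedFieldType makes the canonical topology and
   normed-module structure available on it: these instances are keyed on the
   carrier of an abstract number field and are not found on R[i] itself. *)
Definition Cplx (R : realType) : numClosedFieldType := R[i]%C.

(* The library norm `|z| is Cplx R-valued; this is the R-valued modulus. *)
Definition cabs (R : realType) (z : Cplx R) : R := complex.Re `|z|.

Section SeveralComplexVariables.
Variables (R : realType) (m : nat).
Implicit Types (f : 'rV[Cplx R]_m -> Cplx R) (A : set 'rV[Cplx R]_m).

(* [differentiable] is Frechet differentiability over the scalar field
   Cplx R, i.e. with a C-linear differential. *)
Definition holomorphic_near A f : Prop :=
  exists U : set 'rV[Cplx R]_m,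
    [/\ open U, A `<=` U & forall x, U x -> differentiable f x].

Definition is_max_on A (h : 'rV[Cplx R]_m -> R) (mu : R) : Prop :=
  (exists2 x, A x & h x = mu) /\ (forall x, A x -> h x <= mu).

Definition partial (i : 'I_m) f : 'rV[Cplx R]_m -> Cplx R :=
  fun x => 'D_(delta_mx 0 i) f x.

Definition partials (alpha : 'I_m -> nat) f : 'rV[Cplx R]_m -> Cplx R :=
  foldr (fun i g => iter (alpha i) (partial i) g) f (enum 'I_m).

Definition taylor_coef f (alpha : 'I_m -> nat) : Cplx R :=
  partials alpha f 0 / (\prod_(i < m) (alpha i)`!)%:R.

End SeveralComplexVariables.

(* The variables (z, y_0, ..., y_n) are the coordinates 0, 1, ..., n.+1. *)
Definition polydisk (R : realType) (n : nat) (r rho : R) :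
    set 'rV[Cplx R]_n.+2 :=
  [set x | cabs (x 0 0) <= r /\
           forall l : 'I_n.+1, cabs (x 0 (lift ord0 l)) <= rho].

(* Formal power series, as coefficient sequences. *)
Definition fps (R : realType) : Type := nat -> Cplx R.

Section FormalPowerSeries.
Variable R : realType.
Implicit Types a b : fps R.

Definition fps_one : fps R := fun j => (j == 0)%:R.
Definition fps_X : fps R := fun j => (j == 1)%:R.
Definition fps_mul a b : fps R := fun j => \sum_(i < j.+1) a i * b (j - i)%N.
Definition fps_exp a (e : nat) : fps R := iter e (fps_mul a) fps_one.

Definition fps_delta a : fps R := fun j => j%:R * a j.

Definition fps_delta_add (k : nat) a : fps R :=
  fun j => fps_delta a j + k%:R * a j.

Definition fps_diffop (L : {poly Cplx R}) (k : nat) a : fps R :=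
  fun j => \sum_(i < size L) L`_i * iter i (fps_delta_add k) a j.

(* Substitution of g_0, ..., g_(m-1) in the formal series with coefficients T.
   When all the g_i have zero constant term, a monomial of total degree > j
   does not contribute to the coefficient of order j, whence the finite sum. *)
Definition fps_subst (m : nat) (T : ('I_m -> nat) -> Cplx R)
    (g : 'I_m -> fps R) : fps R :=
  fun j => \sum_(alpha : {ffun 'I_m -> 'I_j.+1} | (\sum_i alpha i <= j)%N)
     T (fun i => alpha i) *
     (\big[fps_mul/fps_one]_(i < m) fps_exp (g i) (alpha i)) j.

(* (z, psi, delta psi, ..., delta^n psi) *)
Definition jet (n : nat) (psi : fps R) : 'I_n.+2 -> fps R :=
  fun i => if (i : nat) is l.+1 then iter l fps_delta psi else fps_X.

End FormalPowerSeries.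

(* Main.v *)
(** Put S_m = sum_(j <= m) j^n |c_j| x^j with x = |z| < R.  Comparing coefficients
    in the equation and using Cauchy's estimates for the Taylor coefficients of M,
    sigma S_(m+1) <= mu x / ((1 - x/r) (1 - S_m/rho)^(n+1)); the choice of R makes
    the bound S_m <= rho/(n+2) propagate by induction, so the series converges
    absolutely.

    Cauchy's estimates are obtained without integration theory.  Goursat's
    bisection argument is run on trapezoid sums over dyadic subdivisions, and the
    integral over a circle is replaced by the limit, along an ultrafilter, of the
    means over the 2^N-th roots of unity: a norm-one linear functional on all
    bounded functions.  This gives Cauchy's formula in one variable for functions
    that are merely complex differentiable, then in several variables by iterating
    the functional; one differentiates under the functional because the difference
    quotients of the Cauchy kernel converge uniformly. *)

Require Import Defs.
From HB Require Import structures.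
From mathcomp Require Import all_boot all_order all_algebra.
From mathcomp Require Import complex.
From mathcomp Require Import all_classical all_reals all_analysis.
From mathcomp Require Import ring lra zify.
Set Implicit Arguments.
Unset Strict Implicit.
Unset Printing Implicit Defensive.
Import Order.TTheory GRing.Theory Num.Theory numFieldNormedType.Exports.
Local Open Scope classical_set_scope.
Local Open Scope ring_scope.

(** * The real-valued modulus on the complex numbers *)

Section ComplexModulus.
Variable R : realType.
Implicit Types (x y : R) (z w : Cplx R).

Definition embc (x : R) : Cplx R := (x%:C)%C.

(** Nonnegativity in [Cplx R] forces a zero imaginary part. This is the bridge that carries facts
    about the library norm over to [cabs]. *)
Lemma normE z : `|z| = embc (cabs z).
Proof.
rewrite /embc /cabs; move: (normr_ge0 z); move: `|z| => [a b].
by rewrite lecE /= => /andP[/eqP -> _].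
Qed.

Lemma embcD x y : embc (x + y) = embc x + embc y.
Proof. exact: (rmorphD (real_complex R)). Qed.

Lemma embcB x y : embc (x - y) = embc x - embc y.
Proof. exact: (rmorphB (real_complex R)). Qed.

Lemma embcM x y : embc (x * y) = embc x * embc y.
Proof. exact: (rmorphM (real_complex R)). Qed.

Lemma embc1 : embc 1 = 1. Proof. by []. Qed.

Lemma embc_nat n : embc n%:R = n%:R.
Proof. exact: (rmorph_nat (real_complex R)). Qed.

Lemma embcX x n : embc (x ^+ n) = embc x ^+ n.
Proof. exact: (rmorphXn (real_complex R)). Qed.

Lemma embcV x : embc x^-1 = (embc x)^-1.
Proof. exact: (fmorphV (real_complex R)). Qed.

Lemma embc_inj : injective embc.
Proof. by move=> x y []. Qed.

Lemma ler_embc x y : (embc x <= embc y) = (x <= y).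
Proof. exact: lecR. Qed.

Lemma ltr_embc x y : (embc x < embc y) = (x < y).
Proof. exact: ltcR. Qed.

Lemma cabs_ge0 z : 0 <= cabs z.
Proof. by rewrite -ler_embc -normE; exact: normr_ge0. Qed.

Lemma cabsD z w : cabs (z + w) <= cabs z + cabs w.
Proof. by rewrite -ler_embc embcD -!normE ler_normD. Qed.

Lemma cabsN z : cabs (- z) = cabs z.
Proof. by apply: embc_inj; rewrite -!normE normrN. Qed.

Lemma cabsB z w : cabs (z - w) <= cabs z + cabs w.
Proof. by rewrite -(cabsN w) cabsD. Qed.

Lemma cabsM z w : cabs (z * w) = cabs z * cabs w.
Proof. by apply: embc_inj; rewrite embcM -!normE normrM. Qed.

Lemma cabsV z : cabs z^-1 = (cabs z)^-1.
Proof. by apply: embc_inj; rewrite embcV -!normE normfV. Qed.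

Lemma cabs_embc x : cabs (embc x) = `|x|.
Proof.
apply: embc_inj; rewrite -normE /embc normc_def /=.
by rewrite expr0n addr0 sqrtr_sqr.
Qed.

Lemma cabs0 : cabs (0 : Cplx R) = 0.
Proof. by rewrite -(normr0 R) -cabs_embc. Qed.

Lemma cabs1 : cabs (1 : Cplx R) = 1.
Proof. by rewrite -(normr1 R) -cabs_embc. Qed.

Lemma cabs_nat n : cabs (n%:R : Cplx R) = n%:R.
Proof. by rewrite -embc_nat cabs_embc normr_nat. Qed.

Lemma cabsX z n : cabs (z ^+ n) = cabs z ^+ n.
Proof. by elim: n => [|n IH]; rewrite ?expr0 ?cabs1 // !exprS cabsM IH. Qed.

Lemma cabs_eq0 z : (cabs z == 0) = (z == 0).
Proof. by rewrite -(inj_eq embc_inj) -normE -(normr_eq0 z). Qed.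

Lemma cabs_gt0 z : (0 < cabs z) = (z != 0).
Proof. by rewrite lt_def cabs_eq0 cabs_ge0 andbT. Qed.

Lemma cabs_sum (I : Type) (s : seq I) (P : pred I) (F : I -> Cplx R) :
  cabs (\sum_(i <- s | P i) F i) <= \sum_(i <- s | P i) cabs (F i).
Proof.
elim/big_ind2: _ => [|a b c d ab cd|//]; first by rewrite cabs0.
by rewrite (le_trans (cabsD _ _)) ?lerD.
Qed.

Lemma cabs_prod (I : Type) (s : seq I) (P : pred I) (F : I -> Cplx R) :
  cabs (\prod_(i <- s | P i) F i) = \prod_(i <- s | P i) cabs (F i).
Proof. exact: (big_morph _ cabsM cabs1). Qed.

Lemma cabs_sub_ge z w : cabs z - cabs w <= cabs (z - w).
Proof. by rewrite lerBlDr -{1}(subrK w z) cabsD. Qed.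

Definition mkc (x y : R) : Cplx R := (x +i* y)%C.

Lemma mkcE x y : mkc x y = embc x + mkc 0 1 * embc y.
Proof.
by apply/eqP; rewrite eq_complex /=; apply/andP; split; apply/eqP;
  rewrite /= ?mul0r ?mulr0 ?mul1r ?subr0 ?addr0 ?add0r.
Qed.

Lemma ReX_ImX z : cabs z ^+ 2 = complex.Re z ^+ 2 + complex.Im z ^+ 2.
Proof. by apply: embc_inj; rewrite embcX -normE -add_Re2_Im2. Qed.

Lemma cabs_i : cabs (mkc 0 1) = 1.
Proof.
apply/eqP; rewrite -(@eqrXn2 _ 2) ?cabs_ge0 //.
by rewrite ReX_ImX /= expr0n add0r.
Qed.

Lemma cabs_mkc x y : cabs (mkc x y) <= `|x| + `|y|.
Proof. by rewrite mkcE (le_trans (cabsD _ _)) // cabsM cabs_i mul1r !cabs_embc. Qed.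

Lemma ReD z w : complex.Re (z + w) = complex.Re z + complex.Re w.
Proof. by case: z; case: w. Qed.

Lemma ImD z w : complex.Im (z + w) = complex.Im z + complex.Im w.
Proof. by case: z; case: w. Qed.

Lemma Re_le z : `|complex.Re z| <= cabs z.
Proof.
rewrite -(@ler_pXn2r _ 2) ?nnegrE ?cabs_ge0 // ReX_ImX real_normK ?num_real //.
by rewrite lerDl sqr_ge0.
Qed.

Lemma Im_le z : `|complex.Im z| <= cabs z.
Proof.
rewrite -(@ler_pXn2r _ 2) ?nnegrE ?cabs_ge0 // ReX_ImX real_normK ?num_real //.
by rewrite lerDr sqr_ge0.
Qed.

(** The tolerance in the library characterisation is a complex number; being positive it is real, so
    real tolerances suffice. *)
Lemma cvg_cabsP (T : Type) (F : set_system T) (FF : Filter F)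
    (u : T -> Cplx R) (l : Cplx R) :
  (u x @[x --> F] --> l) <->
  (forall e : R, 0 < e -> \forall x \near F, cabs (l - u x) < e).
Proof.
split=> [/cvgrPdist_lt h e e0|h].
  have /h : 0 < embc e by rewrite (ltr_embc 0).
  by apply: filterS => x; rewrite normE ltr_embc.
apply/cvgrPdist_lt => eps; rewrite ltcE => /andP[/eqP /= im0 /= re0].
have -> : eps = embc (complex.Re eps).
  by apply/eqP; rewrite eq_complex /= im0 !eqxx.
by have := h _ re0; apply: filterS => x; rewrite normE ltr_embc.
Qed.

Lemma cvg_mkc (T : Type) (F : set_system T) (FF : Filter F)
    (u : T -> Cplx R) (a b : R) :
  complex.Re (u x) @[x --> F] --> a -> complex.Im (u x) @[x --> F] --> b ->
  u x @[x --> F] --> mkc a b.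
Proof.
move=> /cvgrPdist_lt ha /cvgrPdist_lt hb; apply/cvg_cabsP => e e0.
have e2 : 0 < e / 2 by rewrite divr_gt0.
apply: filterS2 (ha _ e2) (hb _ e2) => x h1 h2.
have -> : mkc a b - u x = mkc (a - complex.Re (u x)) (b - complex.Im (u x)).
  by case: (u x).
by rewrite (le_lt_trans (cabs_mkc _ _)) // (splitr e) ltrD.
Qed.

(** The real and imaginary parts are dominated by the modulus, so both are absolutely convergent
    real series. *)
Lemma cvgn_series_abs (u : nat -> Cplx R) (B : R) :
  (forall N, \sum_(0 <= j < N) cabs (u j) <= B) -> cvgn (series u).
Proof.
move=> hB.
have cabsC : cvgn (series (fun j => cabs (u j))).
  apply: nondecreasing_is_cvgn.
    by apply/nondecreasing_seqP => N; rewrite seriesSr lerDl cabs_ge0.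
  by exists B => _ [N _ <-]; exact: hB.
have real_cvg (v : nat -> R) : (forall j, `|v j| <= cabs (u j)) ->
    cvgn (series v).
  move=> hv; apply: normed_cvg; apply: series_le_cvg cabsC => j /=.
  - exact: normr_ge0.
  - exact: cabs_ge0.
  - exact: hv.
have hRe := real_cvg (fun j => complex.Re (u j)) (fun j => Re_le (u j)).
have hIm := real_cvg (fun j => complex.Im (u j)) (fun j => Im_le (u j)).
have ReS N : complex.Re (series u N) = series (fun j => complex.Re (u j)) N.
  elim: N => [|N IH]; first by rewrite /series /= !big_geq.
  by rewrite !seriesSr ReD IH.
have ImS N : complex.Im (series u N) = series (fun j => complex.Im (u j)) N.
  elim: N => [|N IH]; first by rewrite /series /= !big_geq.
  by rewrite !seriesSr ImD IH.
apply/cvg_ex; eexists; apply: cvg_mkc.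
  by under eq_fun do rewrite ReS; exact: hRe.
by under eq_fun do rewrite ImS; exact: hIm.
Qed.

End ComplexModulus.

(** * Dyadic bisection of the unit square *)

Section Cousin.
Variable R : realType.

(** The quotients a l / 2^l are truncated binary expansions with digits [d]. They increase while the
    right endpoints decrease, so their supremum lies in every interval. *)
Lemma dyadic_address_limit (a : nat -> nat) (d : nat -> bool) :
  a 0%N = 0%N -> (forall l, a l.+1 = (2 * a l + d l)%N) ->
  exists2 s : R, 0 <= s <= 1 & forall l,
    (a l < 2 ^ l)%N /\ (a l)%:R / 2 ^+ l <= s <= (a l).+1%:R / 2 ^+ l.
Proof.
move=> a0 aS.
pose x l : R := (a l)%:R / 2 ^+ l.
pose y l : R := (a l).+1%:R / 2 ^+ l.
have p0 l : 0 < 2 ^+ l :> R by rewrite exprn_gt0.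
have lexy l : x l <= y l by rewrite ler_pM2r ?invr_gt0 // ler_nat.
have dS l : 0 <= (d l)%:R :> R /\ (d l)%:R <= 1 :> R.
  by case: (d l); rewrite ?lexx ?ler01.
have ndx : nondecreasing_seq x.
  apply/nondecreasing_seqP => l; rewrite /x aS exprS natrD natrM invfM mulrA.
  by rewrite ler_pM2r ?invr_gt0 // ler_pdivlMr // mulrC lerDl; case: (dS l).
have niy : nonincreasing_seq y.
  apply/nonincreasing_seqP => l; rewrite /y aS exprS -addn1 natrD natrD natrM.
  rewrite invfM mulrA ler_pM2r ?invr_gt0 // ler_pdivrMr // -[(a l).+1]addn1 natrD.
  by case: (dS l); lra.
have xy l m : x l <= y m.
  apply: le_trans (ndx _ _ (leq_maxl l m)) _.
  exact: le_trans (lexy _) (niy _ _ (leq_maxr l m)).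
have hs : has_sup (range x).
  by split; [exists (x 0%N), 0%N|exists (y 0%N) => _ [l _ <-]].
have xs l : x l <= sup (range x) by apply: sup_upper_bound => //; exists l.
have sy l : sup (range x) <= y l.
  by apply: ge_sup; [exists (x 0%N), 0%N|move=> _ [m _ <-]].
exists (sup (range x)).
  have := xs 0%N; have := sy 0%N; rewrite /x /y a0 expr0 !divr1 => -> /=.
  by move=> ->.
move=> l; split; last by rewrite [X in X && _]xs [X in _ && X]sy.
elim: l => [|l IH]; first by rewrite a0.
by rewrite aS expnS; case: (d l); lia.
Qed.

(** [P l a b] speaks of the dyadic cell of side 2^-l with lower left corner (a, b) / 2^l. A failure
    on the whole square would pass to one quarter at each level; the nested cells close down on a
    point (s, t), where the local hypothesis contradicts it. *)
Lemma dyadic_cousin (P : nat -> nat -> nat -> Prop) :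
  (forall l a b, (forall i j : bool, P l.+1 (2 * a + i)%N (2 * b + j)%N) ->
    P l a b) ->
  (forall s t : R, 0 <= s <= 1 -> 0 <= t <= 1 ->
    exists L, forall l a b, (L <= l)%N -> (a < 2 ^ l)%N -> (b < 2 ^ l)%N ->
      a%:R / 2 ^+ l <= s <= a.+1%:R / 2 ^+ l ->
      b%:R / 2 ^+ l <= t <= b.+1%:R / 2 ^+ l -> P l a b) ->
  P 0%N 0%N 0%N.
Proof.
move=> Psub Ploc; apply: contrapT => nP0.
(* One choice function serves all cells; on a cell where [P] holds its value is arbitrary. *)
have /boolp.choice[f hf] : forall q : nat * (nat * nat), exists ij : bool * bool,
    ~ P q.1 q.2.1 q.2.2 ->
    ~ P q.1.+1 (2 * q.2.1 + ij.1)%N (2 * q.2.2 + ij.2)%N.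
  move=> -[l [a b]] /=.
  have [h|h] := pselect (P l a b); first by exists (true, true) => /(_ h).
  apply: contrapT => /forallNP H; apply: h; apply: Psub => i j.
  by have := H (i, j); rewrite not_implyE /= => -[_ /contrapT].
pose u := fix u l : nat * nat := if l is l'.+1 then
  ((2 * (u l').1 + (f (l', u l')).1)%N, (2 * (u l').2 + (f (l', u l')).2)%N)
  else (0%N, 0%N).
have nP l : ~ P l (u l).1 (u l).2.
  by elim: l => [//|l IH]; exact: (hf (l, u l)).
have [s s01 hs] := @dyadic_address_limit (fun l => (u l).1)
  (fun l => (f (l, u l)).1) erefl (fun=> erefl).
have [t t01 ht] := @dyadic_address_limit (fun l => (u l).2)
  (fun l => (f (l, u l)).2) erefl (fun=> erefl).
have [L hL] := Ploc s t s01 t01.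
by apply: (nP L); apply: hL => //; [case: (hs L)|case: (ht L)|case: (hs L)|case: (ht L)].
Qed.

End Cousin.

(** * Trapezoid sums and a discrete Goursat lemma *)

Section Trapezoid.
Variable R : realType.
Implicit Types (g : Cplx R -> Cplx R) (p : nat -> Cplx R).

(* Trapezoid sum of g along the polygon p 0, ..., p K. *)
Definition chain g p (K : nat) : Cplx R :=
  \sum_(i < K) (g (p i) + g (p i.+1)) / 2 * (p i.+1 - p i).

Lemma chainD g p K K' :
  chain g p (K + K') = chain g p K + chain g (fun i => p (K + i)%N) K'.
Proof.
rewrite /chain big_split_ord /=; congr (_ + _).
by apply: eq_bigr => i _; rewrite -addnS.
Qed.

(* The trapezoid rule integrates affine functions exactly. *)
Lemma chain_affine g p K (u d z0 : Cplx R) (eta lam : R) :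
  (forall i, (i <= K)%N -> cabs (g (p i) - (u + d * (p i - z0))) <= eta) ->
  (forall i, (i < K)%N -> cabs (p i.+1 - p i) <= lam) ->
  cabs (chain g p K - ((u - d * z0) * (p K - p 0%N) +
     d * (p K ^+ 2 - p 0%N ^+ 2) / 2)) <= K%:R * (eta * lam).
Proof.
elim: K => [|K IH] hg hp.
  by rewrite /chain big_ord0 !subrr !mulr0 mul0r addr0 subrr cabs0 mul0r.
have {}IH := IH (fun i hi => hg i (leqW hi)) (fun i hi => hp i (leqW hi)).
rewrite /chain big_ord_recr /= -/(chain g p K).
set A := chain g p K in IH *; set B := (X in cabs (A - X)) in IH.
pose c i := g (p i) - (u + d * (p i - z0)).
have two : (2 : Cplx R) != 0 by rewrite pnatr_eq0.
(* [B] is the increment of the primitive (u - d z0) z + d z^2 / 2 of the affine function. A new edge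
   adds only the average of its two endpoint errors times its length. *)
have -> : A + (g (p K) + g (p K.+1)) / 2 * (p K.+1 - p K) -
   ((u - d * z0) * (p K.+1 - p 0%N) + d * (p K.+1 ^+ 2 - p 0%N ^+ 2) / 2) =
   (A - B) + (c K + c K.+1) / 2 * (p K.+1 - p K).
  by rewrite /c /B; field.
have -> : K.+1%:R * (eta * lam) = K%:R * (eta * lam) + eta * lam.
  by rewrite -natr1 mulrDl mul1r.
apply: le_trans (cabsD _ _) (lerD IH _).
rewrite !cabsM cabsV cabs_nat; apply: ler_pM => //; last exact: hp.
- by rewrite divr_ge0 ?cabs_ge0.
- exact: cabs_ge0.
rewrite ler_pdivrMr // mulr_natr mulr2n (le_trans (cabsD _ _)) // lerD //.
  by apply: hg.
by apply: hg.
Qed.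

(** Contour sum, counterclockwise in the grid parameters, around the K by K block with lower left
    corner (A, B). *)
Definition box g (G : nat -> nat -> Cplx R) (A B K : nat) : Cplx R :=
  chain g (fun i => G (A + i)%N B) K + chain g (fun i => G (A + K)%N (B + i)%N) K
  - chain g (fun i => G (A + i)%N (B + K)%N) K - chain g (fun i => G A (B + i)%N) K.

(** Each inner edge is traversed twice, with opposite signs. *)
Lemma box_split g G A B K :
  box g G A B (K + K) = box g G A B K + box g G A (B + K) K
    + box g G (A + K) B K + box g G (A + K) (B + K) K.
Proof.
rewrite /box !chainD.
have E1 b : (fun i => G (A + (K + i))%N b) = (fun i => G (A + K + i)%N b).
  by apply: funext => i; rewrite addnA.
have E2 a : (fun i => G a (B + (K + i))%N) = (fun i => G a (B + K + i)%N).
  by apply: funext => i; rewrite addnA.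
rewrite !E1 !E2 !addnA; ring.
Qed.

(** The increments of the primitive of the affine part cancel around the closed contour, which
    leaves the errors of [chain_affine] on the four sides. *)
Lemma box_affine g G A B K (u d z0 : Cplx R) (eta lam : R) :
  (forall i j, (i <= K)%N -> (j <= K)%N ->
    cabs (g (G (A + i)%N (B + j)%N) - (u + d * (G (A + i)%N (B + j)%N - z0)))
      <= eta) ->
  (forall i j, (i < K)%N -> (j <= K)%N ->
    cabs (G (A + i.+1)%N (B + j)%N - G (A + i)%N (B + j)%N) <= lam) ->
  (forall i j, (i <= K)%N -> (j < K)%N ->
    cabs (G (A + i)%N (B + j.+1)%N - G (A + i)%N (B + j)%N) <= lam) ->
  cabs (box g G A B K) <= 4 * (K%:R * (eta * lam)).
Proof.
move=> hg hx hy.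
pose Q (p : nat -> Cplx R) := (u - d * z0) * (p K - p 0%N) +
     d * (p K ^+ 2 - p 0%N ^+ 2) / 2.
set E := _ * (eta * lam).
pose p1 i := G (A + i)%N (B + 0)%N; pose p2 i := G (A + K)%N (B + i)%N.
pose p3 i := G (A + i)%N (B + K)%N; pose p4 i := G (A + 0)%N (B + i)%N.
have h1 : cabs (chain g p1 K - Q p1) <= E.
  by apply: chain_affine => i hi; [apply: hg|apply: hx].
have h2 : cabs (chain g p2 K - Q p2) <= E.
  by apply: chain_affine => i hi; [apply: hg|apply: hy].
have h3 : cabs (chain g p3 K - Q p3) <= E.
  by apply: chain_affine => i hi; [apply: hg|apply: hx].
have h4 : cabs (chain g p4 K - Q p4) <= E.
  by apply: chain_affine => i hi; [apply: hg|apply: hy].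
have -> : box g G A B K = (chain g p1 K - Q p1) + (chain g p2 K - Q p2)
    - (chain g p3 K - Q p3) - (chain g p4 K - Q p4).
  rewrite /box /Q /p1 /p2 /p3 /p4 !addn0.
  have two : (2 : Cplx R) != 0 by rewrite pnatr_eq0.
  by field.
apply: le_trans (cabsB _ _) _; apply: (@le_trans _ _ (E + E + E + E)); last by lra.
apply: lerD h4; apply: le_trans (cabsB _ _) _; apply: lerD h3.
by apply: le_trans (cabsD _ _) _; apply: lerD.
Qed.

Definition cdiff_at g (z : Cplx R) : Prop :=
  exists d : Cplx R, forall e : R, 0 < e -> exists2 del : R, 0 < del &
    forall w, cabs (w - z) < del ->
      cabs (g w - g z - d * (w - z)) <= e * cabs (w - z).

(* Goursat's lemma in discrete form: no integral is taken, the trapezoid sums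
   along the images of the sides of the dyadic grid tend to 0. *)
Lemma goursat g (gam : R -> R -> Cplx R) (C : R) : 0 < C ->
  (forall s s' t t', 0 <= s <= 1 -> 0 <= s' <= 1 -> 0 <= t <= 1 -> 0 <= t' <= 1 ->
    cabs (gam s t - gam s' t') <= C * (`|s - s'| + `|t - t'|)) ->
  (forall s t, 0 <= s <= 1 -> 0 <= t <= 1 -> cdiff_at g (gam s t)) ->
  forall e : R, 0 < e -> exists N0, forall N, (N0 <= N)%N ->
    cabs (box g (fun i j => gam (i%:R / 2 ^+ N) (j%:R / 2 ^+ N)) 0 0 (2 ^ N)) <= e.
Proof.
move=> C0 lip dg e e0.
pose GN N (i j : nat) := gam (i%:R / 2 ^+ N) (j%:R / 2 ^+ N).
(* The bound is proportional to the area of the cell, so the bounds for the four quarters add up to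
   the bound for the cell. *)
pose P l a b := exists N0, forall N, (N0 <= N)%N -> (l <= N)%N ->
  cabs (box g (GN N) (a * 2 ^ (N - l)) (b * 2 ^ (N - l)) (2 ^ (N - l)))
    <= e / 4 ^+ l.
have p0 l : 0 < 2 ^+ l :> R by rewrite exprn_gt0.
suff [N0 hN0] : P 0%N 0%N 0%N.
  exists N0 => N hN; have := hN0 N hN (leq0n _).
  by rewrite !mul0n subn0 expr0 divr1.
apply: (@dyadic_cousin R).
  move=> l a b hP.
  have [N1 h1] := hP false false; have [N2 h2] := hP false true.
  have [N3 h3] := hP true false; have [N4 h4] := hP true true.
  exists (maxn l.+1 (maxn (maxn N1 N2) (maxn N3 N4))) => N.
  rewrite !geq_max => /and3P[lN /andP[n1 n2] /andP[n3 n4]] _.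
  have {h1} := h1 N n1 lN; have {h2} := h2 N n2 lN.
  have {h3} := h3 N n3 lN; have {h4} := h4 N n4 lN.
  set K := (2 ^ (N - l.+1))%N.
  have -> : (2 ^ (N - l) = K + K)%N by rewrite -(subnSK lN) expnS mul2n -addnn.
  have Ei (c : nat) (i : bool) : ((2 * c + i) * K = c * (K + K) + i * K)%N by lia.
  rewrite !Ei !mul0n !addn0 !mul1n box_split exprS.
  move=> h4 h3 h2 h1.
  apply: le_trans (cabsD _ _) _.
  have -> : e / 4 ^+ l = e / (4 * 4 ^+ l) + e / (4 * 4 ^+ l) + e / (4 * 4 ^+ l)
     + e / (4 * 4 ^+ l).
    by field; rewrite expf_neq0.
  apply: lerD h4; apply: le_trans (cabsD _ _) _; apply: lerD h3.
  by apply: le_trans (cabsD _ _) _; apply: lerD.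
move=> s t s01 t01; have [d hd] := dg s t s01 t01.
(* The tolerance is chosen so that 4 K eta lam is exactly e / 4^l in [box_affine], with K = 2^(N-l),
   lam = C / 2^N and eta the tolerance times 2 C / 2^l. *)
have [del del0 hdel] := hd (e / (8 * C ^+ 2))
  (divr_gt0 e0 (mulr_gt0 (ltr0n _ 8) (exprn_gt0 2 C0))).
(* By the Lipschitz bound, 2 C / 2^l controls the distance from [gam s t] to the image of any grid
   point of a level l cell containing (s, t). The level is found from L < 2^L. *)
have [L hL] : exists L : nat, 2 * C / 2 ^+ L < del.
  exists (Num.trunc (2 * C / del)).+1.
  have := ltn_expl (Num.trunc (2 * C / del)).+1 (ltnSn 1).
  rewrite -(ltr_nat R) natrX => h.
  rewrite ltr_pdivrMr // [_ * 2 ^+ _]mulrC -ltr_pdivrMr //.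
  exact: lt_trans (truncnS_gt _) h.
exists L => l a b Ll al bl hs ht; exists 0%N => N _ lN.
have Nl : 2 ^+ N = 2 ^+ (N - l) * 2 ^+ l :> R by rewrite -exprD subnK.
have pt (c : nat) (i : nat) (v : R) : (c < 2 ^ l)%N -> (i <= 2 ^ (N - l))%N ->
    c%:R / 2 ^+ l <= v <= c.+1%:R / 2 ^+ l ->
    0 <= ((c * 2 ^ (N - l) + i)%:R / 2 ^+ N : R) <= 1 /\
    `|(c * 2 ^ (N - l) + i)%:R / 2 ^+ N - v| <= (2 ^+ l)^-1.
  move=> cl iK /andP[hv1 hv2].
  have lo : c%:R / 2 ^+ l <= (c * 2 ^ (N - l) + i)%:R / 2 ^+ N :> R.
    rewrite ler_pdivlMr // Nl natrD natrM natrX mulrA mulrAC mulfVK ?gt_eqF //.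
    by rewrite lerDl.
  have hi : (c * 2 ^ (N - l) + i)%:R / 2 ^+ N <= c.+1%:R / 2 ^+ l :> R.
    rewrite ler_pdivrMr // Nl mulrA mulrAC mulfVK ?gt_eqF // -natrX -natrM ler_nat.
    by rewrite mulSn addnC leq_add2r.
  have c1 : c.+1%:R / 2 ^+ l <= 1 :> R.
    by rewrite ler_pdivrMr // mul1r -natrX ler_nat.
  have c0 : 0 <= c%:R / 2 ^+ l :> R by rewrite divr_ge0 // ltW.
  have cS : c.+1%:R / 2 ^+ l = c%:R / 2 ^+ l + (2 ^+ l)^-1 :> R.
    by rewrite -natr1 mulrDl mul1r.
  split; first by apply/andP; split; lra.
  by rewrite ler_distl; apply/andP; split; lra.
have step (c i : nat) : (c + i.+1)%:R / 2 ^+ N - (c + i)%:R / 2 ^+ N = (2 ^+ N)^-1 :> R.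
  by rewrite -mulrBl addnS -natr1 addrAC subrr add0r mul1r.
have iN : 0 <= (2 ^+ N)^-1 :> R by rewrite invr_ge0 ltW.
have -> : e / 4 ^+ l = 4 * ((2 ^ (N - l))%:R *
    ((e / (8 * C ^+ 2) * (2 * C / 2 ^+ l)) * (C / 2 ^+ N))).
  have -> : 4 ^+ l = 2 ^+ l * 2 ^+ l :> R by rewrite -exprMn -natrM.
  rewrite natrX Nl; field.
  by rewrite !expf_neq0 // gt_eqF.
apply: (@box_affine _ _ _ _ _ (g (gam s t)) d (gam s t)).
- move=> i j iK jK; rewrite /GN.
  have [i01 di] := pt a i s al iK hs; have [j01 dj] := pt b j t bl jK ht.
  rewrite opprD addrA.
  have dist : cabs (gam ((a * 2 ^ (N - l) + i)%:R / 2 ^+ N)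
      ((b * 2 ^ (N - l) + j)%:R / 2 ^+ N) - gam s t) <= 2 * C / 2 ^+ l.
    apply: le_trans (lip _ _ _ _ i01 s01 j01 t01) _.
    by rewrite [2 * C]mulrC -mulrA ler_pM2l //; lra.
  apply: le_trans (hdel _ _) _.
    apply: le_lt_trans dist _; apply: le_lt_trans hL.
    rewrite ler_pM2l ?mulr_gt0 // lef_pV2 ?posrE // ler_eXn2l ?ltr1n //.
  by rewrite ler_wpM2l // divr_ge0 ?(ltW e0) // mulr_ge0 // exprn_ge0 // ltW.
- move=> i j iK jK; rewrite /GN.
  have [i01 _] := pt a i s al (ltnW iK) hs; have [i01' _] := pt a i.+1 s al iK hs.
  have [j01 _] := pt b j t bl jK ht.
  apply: le_trans (lip _ _ _ _ i01' i01 j01 j01) _.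
  by rewrite step subrr normr0 addr0 ger0_norm.
- move=> i j iK jK; rewrite /GN.
  have [j01 _] := pt b j t bl (ltnW jK) ht; have [j01' _] := pt b j.+1 t bl jK ht.
  have [i01 _] := pt a i s al iK hs.
  apply: le_trans (lip _ _ _ _ i01 i01 j01' j01) _.
  by rewrite step subrr normr0 add0r ger0_norm.
Qed.

End Trapezoid.

(** * Limits of dyadic means along an ultrafilter *)

Section Means.
Variable R : realType.

Definition bounded_fct (T : Type) (phi : T -> Cplx R) : Prop :=
  exists B, forall t, cabs (phi t) <= B.

(** Linearity is restricted to bounded functions because only there is the limit along the
    ultrafilter guaranteed to exist. The second clause says that the norm is at most one. *)
Definition mean_functional (T : Type) (Lam : (T -> Cplx R) -> Cplx R) : Prop :=
  (forall phi psi a b, bounded_fct phi -> bounded_fct psi ->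
     Lam (fun t => a * phi t + b * psi t) = a * Lam phi + b * Lam psi) /\
  (forall phi B, (forall t, cabs (phi t) <= B) -> cabs (Lam phi) <= B).

Definition free_ultrafilter : set_system nat :=
  projT1 (cid (ultraFilterLemma eventually_filter)).

Lemma free_ultraP : UltraFilter free_ultrafilter.
Proof. by rewrite /free_ultrafilter; case: cid => U []. Qed.

Lemma free_ultra_proper : ProperFilter free_ultrafilter.
Proof. exact: (@ultra_proper _ _ free_ultraP). Qed.

Lemma free_ultra_eventually : \oo `<=` free_ultrafilter.
Proof. by rewrite /free_ultrafilter; case: cid => U []. Qed.

#[local] Existing Instance free_ultra_proper.

(** Compactness of the segment gives a cluster point. The ultrafilter contains the preimage of each
    neighbourhood or of its complement, and clustering excludes the latter, so the cluster point is
    a limit. *)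
Lemma ultra_bounded_cvgR (u : nat -> R) (B : R) :
  (forall N, `|u N| <= B) -> cvg (u x @[x --> free_ultrafilter]).
Proof.
move=> hB.
have FB : (u x @[x --> free_ultrafilter]) [set` `[- B, B]].
  by apply: (@filterE _ free_ultrafilter) => N /=; rewrite in_itv /= -ler_norml.
have [p [_ clp]] := @segment_compact R (- B) B _ _ FB.
apply/cvg_ex; exists p => A nA; rewrite /nbhs /=.
have [//|hc] := in_ultra_setVsetC (u @^-1` A) free_ultraP.
by have [y []] := clp (~` A) A hc nA.
Qed.

Lemma ultra_bounded_cvg (u : nat -> Cplx R) (B : R) :
  (forall N, cabs (u N) <= B) -> cvg (u x @[x --> free_ultrafilter]).
Proof.
move=> hB; apply/cvg_ex; eexists; apply: cvg_mkc.
- by apply: (@ultra_bounded_cvgR _ B) => N; exact: le_trans (Re_le _) (hB N).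
- by apply: (@ultra_bounded_cvgR _ B) => N; exact: le_trans (Im_le _) (hB N).
Qed.

Definition dyadic_mean (N : nat) (phi : R -> Cplx R) : Cplx R :=
  (\sum_(j < 2 ^ N) phi (j%:R / 2 ^+ N)) / 2 ^+ N.

(* The integral over the circle, for circle parameters in [0, 1]; taking the
   limit along an ultrafilter makes it defined on all bounded functions. *)
Definition Lam (phi : R -> Cplx R) : Cplx R :=
  lim (dyadic_mean N phi @[N --> free_ultrafilter]).

Lemma dyadic_mean_le N phi B : (forall t, cabs (phi t) <= B) ->
  cabs (dyadic_mean N phi) <= B.
Proof.
move=> hB; rewrite /dyadic_mean cabsM cabsV cabsX cabs_nat.
rewrite ler_pdivrMr ?exprn_gt0 // (le_trans (cabs_sum _ _ _)) //.
apply: le_trans (ler_sum _ (fun j _ => hB _)) _.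
by rewrite sumr_const card_ord -natrX mulr_natr.
Qed.

Lemma dyadic_mean_lin N phi psi a b :
  dyadic_mean N (fun t => a * phi t + b * psi t) =
  a * dyadic_mean N phi + b * dyadic_mean N psi.
Proof. by rewrite /dyadic_mean big_split -!mulr_sumr mulrDl !mulrA. Qed.

Lemma dyadic_mean_cst N c : dyadic_mean N (fun=> c) = c.
Proof.
rewrite /dyadic_mean sumr_const card_ord -[c *+ _]mulr_natr natrX mulfK //.
Qed.

Lemma Lam_cvg phi : bounded_fct phi ->
  dyadic_mean N phi @[N --> free_ultrafilter] --> Lam phi.
Proof.
move=> [B hB]; apply: (@ultra_bounded_cvg _ B) => N; exact: dyadic_mean_le.
Qed.

Lemma ultra_lim_unique (u : nat -> Cplx R) (l l' : Cplx R) :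
  u x @[x --> free_ultrafilter] --> l -> u x @[x --> free_ultrafilter] --> l' ->
  l = l'.
Proof. by move=> h h'; apply: cvg_unique h h'; exact: norm_hausdorff. Qed.

Lemma Lam_mean : mean_functional Lam.
Proof.
split=> [phi psi a b hphi hpsi|phi B hB].
  apply: (@ultra_lim_unique
    (fun N => dyadic_mean N (fun t => a * phi t + b * psi t))).
    apply: Lam_cvg; case: hphi hpsi => [B hB] [B' hB'].
    exists (cabs a * B + cabs b * B') => t.
    rewrite (le_trans (cabsD _ _)) // !cabsM.
    by rewrite lerD ?ler_wpM2l ?cabs_ge0.
  under eq_fun do rewrite dyadic_mean_lin.
  by apply: cvgD; apply: cvgMr; exact: Lam_cvg.
rewrite leNgt; apply/negP => ltB.
have /cvg_cabsP/(_ (cabs (Lam phi) - B)) := Lam_cvg (ex_intro _ B hB).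
rewrite subr_gt0 => /(_ ltB)/filter_ex[N hN].
have := dyadic_mean_le N hB; have := cabs_sub_ge (Lam phi) (dyadic_mean N phi).
by move: hN; lra.
Qed.

Lemma Lam_cst c : Lam (fun=> c) = c.
Proof.
apply: (@ultra_lim_unique (fun N => dyadic_mean N (fun=> c))).
  by apply: Lam_cvg; exists (cabs c).
by under eq_fun do rewrite dyadic_mean_cst; exact: cvg_cst.
Qed.

(** The ultrafilter refines the filter of tails, so a difference of means that tends to 0 in the
    ordinary sense also has limit 0 along it. *)
Lemma Lam_eq phi psi : bounded_fct phi -> bounded_fct psi ->
  (forall e : R, 0 < e -> exists N0, forall N, (N0 <= N)%N ->
     cabs (dyadic_mean N phi - dyadic_mean N psi) <= e) ->
  Lam phi = Lam psi.
Proof.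
move=> hphi hpsi h; apply/eqP; rewrite -subr_eq0; apply/eqP.
apply: (@ultra_lim_unique (fun N => dyadic_mean N phi - dyadic_mean N psi)).
  by apply: cvgB; exact: Lam_cvg.
apply: cvg_trans (cvg_app _ free_ultra_eventually) _.
apply/cvg_cabsP => e e0; have [N0 hN0] := h _ (divr_gt0 e0 (ltr0n _ 2)).
exists N0 => // N /= hN; rewrite sub0r cabsN; apply: le_lt_trans (hN0 _ hN) _.
by lra.
Qed.

Lemma mean_functionalB T (F : (T -> Cplx R) -> Cplx R) phi psi :
  mean_functional F -> bounded_fct phi -> bounded_fct psi ->
  F (fun t => phi t - psi t) = F phi - F psi.
Proof.
move=> [lin _] h h'; have := lin phi psi 1 (-1) h h'.
rewrite mul1r mulN1r => <-; congr F; apply: funext => t.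
by rewrite mul1r mulN1r.
Qed.

Lemma mean_functionalZ T (F : (T -> Cplx R) -> Cplx R) phi c :
  mean_functional F -> bounded_fct phi ->
  F (fun t => c * phi t) = c * F phi.
Proof.
move=> [lin _] h; have := lin phi phi c 0 h h.
rewrite mul0r addr0 => <-; congr F; apply: funext => t.
by rewrite mul0r addr0.
Qed.

End Means.

(** * Roots of unity and Cauchy's formula in one variable *)

Section Circle.
Variable R : realType.

Definition circ (t : R) : Cplx R := mkc (cos (pi *+ 2 * t)) (sin (pi *+ 2 * t)).

Lemma circD s t : circ (s + t) = circ s * circ t.
Proof.
rewrite /circ mulrDr cosD sinD; apply/eqP; rewrite eq_complex /=.
by rewrite eqxx addrC eqxx.
Qed.

Lemma circ0 : circ 0 = 1.
Proof. by rewrite /circ mulr0 cos0 sin0. Qed.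

Lemma circ1 : circ 1 = 1.
Proof. by rewrite /circ mulr1 cos2pi sin2pi. Qed.

Lemma cabs_circ t : cabs (circ t) = 1.
Proof.
apply/eqP; rewrite -(@eqrXn2 _ 2) ?cabs_ge0 //.
by rewrite ReX_ImX /= cos2Dsin2 expr1n.
Qed.

Lemma lipschitz1_deriv (h dh : R -> R) :
  (forall x : R, is_derive x 1 h (dh x)) -> (forall x, `|dh x| <= 1) ->
  forall a b, `|h a - h b| <= `|a - b|.
Proof.
move=> hd hle a b; wlog ab : a b / a <= b.
  by move=> H; case: (leP a b) => [/H//|/ltW /H]; rewrite !(distrC _ a) !(distrC _ (h a)).
have [|c _ E] := @MVT_segment R h dh a b ab (fun x _ => hd x).
  by apply: derivable_within_continuous => x _; case: (hd x).
by rewrite distrC E normrM distrC ler_piMl.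
Qed.

Lemma circ_lipschitz : exists2 C : R, 0 < C &
  forall s t, cabs (circ s - circ t) <= C * `|s - t|.
Proof.
have p0 : 0 < pi *+ 2 :> R by rewrite mulrn_wgt0 // pi_gt0.
exists (2 * (pi *+ 2)); first by rewrite mulr_gt0.
move=> s t.
have -> : circ s - circ t = mkc (cos (pi *+ 2 * s) - cos (pi *+ 2 * t))
   (sin (pi *+ 2 * s) - sin (pi *+ 2 * t)) by [].
apply: le_trans (cabs_mkc _ _) _.
have E : `|pi *+ 2 * s - pi *+ 2 * t| = pi *+ 2 * `|s - t| :> R.
  by rewrite -mulrBr normrM gtr0_norm.
have h1 := @lipschitz1_deriv cos (fun x => - sin x)
  (fun x => is_derive_cos x) _ (pi *+ 2 * s) (pi *+ 2 * t).
have h2 := @lipschitz1_deriv sin cos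
  (fun x => is_derive_sin x) (fun x => cos_max x) (pi *+ 2 * s) (pi *+ 2 * t).
have -> : 2 * (pi *+ 2) * `|s - t| = pi *+ 2 * `|s - t| + pi *+ 2 * `|s - t| :> R.
  by rewrite -mulrA mulr_natl mulr2n.
rewrite -E; apply: lerD => //.
by apply: h1 => x; rewrite normrN sin_max.
Qed.

(* Doubling the number of points can only increase 2^N |sin(2 pi / 2^N)|,
   whose value at N = 2 is 4. *)
Lemma sin_dyadic_ge (N : nat) :
  4 <= 2 ^+ N.+2 * `|sin (pi *+ 2 * (1 / 2 ^+ N.+2) : R)|.
Proof.
elim: N => [|N IH].
  have -> : pi *+ 2 * (1 / 2 ^+ 2) = pi / 2 :> R by rewrite -mulr_natr; field.
  by rewrite sin_pihalf normr1 mulr1 -natrX.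
apply: le_trans IH _; set t : R := pi *+ 2 * (1 / 2 ^+ N.+3).
have -> : pi *+ 2 * (1 / 2 ^+ N.+2) = t *+ 2 :> R.
  by rewrite /t [2 ^+ N.+3]exprS; field; rewrite expf_neq0.
set P : R := 2 ^+ N.+2; have P0 : 0 <= P by rewrite exprn_ge0.
have -> : 2 ^+ N.+3 = 2 * P by rewrite /P exprS.
rewrite sin_mulr2n normrMn normrM -subr_ge0.
have -> : 2 * P * `|sin t| - P * (`|cos t| * `|sin t| *+ 2) =
  2 * P * (`|sin t| - `|cos t| * `|sin t|) by ring.
apply: mulr_ge0; first exact: mulr_ge0.
by rewrite subr_ge0 ler_piMl // cos_max.
Qed.

(** Consecutive vertices, seen from the centre, differ by the rotation w = exp(2 i pi / 2^N), so an
    edge is w - 1 times its start and 1 - 1/w times its end. Reindexing the closed polygon produces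
    (w - 1/w) / 2 = i sin(2 pi / 2^N). This factor depends on neither centre nor radius, so sums
    over different circles can be compared. *)
Lemma chain_circ (g : Cplx R -> Cplx R) (x0 rh : Cplx R) (N : nat) :
  chain g (fun j => x0 + rh * circ (j%:R / 2 ^+ N)) (2 ^ N) =
  mkc 0 (sin (pi *+ 2 * (1 / 2 ^+ N))) * 2 ^+ N *
    dyadic_mean N (fun t => g (x0 + rh * circ t) * (rh * circ t)).
Proof.
set w := circ (1 / 2 ^+ N); set w' := circ (- (1 / 2 ^+ N)).
pose c j := circ (j%:R / 2 ^+ N).
have cS j : c j.+1 = c j * w by rewrite /c -natr1 mulrDl circD.
have ww' : w * w' = 1 by rewrite -circD subrr circ0.
have two : (2 : Cplx R) != 0 by rewrite pnatr_eq0.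
have sinE : mkc 0 (sin (pi *+ 2 * (1 / 2 ^+ N))) = (w - w') / 2.
  apply: (mulIf two); rewrite divfK // /w /w' /circ mulrN cosN sinN.
  rewrite mulr_natr mulr2n; apply/eqP; rewrite eq_complex /=.
  by rewrite addr0 subrr opprK !eqxx.
pose G j := g (x0 + rh * c j) * (rh * c j).
have term j : (g (x0 + rh * c j) + g (x0 + rh * c j.+1)) / 2 *
    (x0 + rh * c j.+1 - (x0 + rh * c j)) =
    (w - 1) / 2 * G j + (1 - w') / 2 * G j.+1.
  rewrite /G; have -> : (1 - w') / 2 * (g (x0 + rh * c j.+1) * (rh * c j.+1)) =
    g (x0 + rh * c j.+1) / 2 * (rh * (c j.+1 - c j)).
    have -> : c j.+1 - c j = c j.+1 * (1 - w').
      by rewrite mulrBr mulr1 cS -mulrA ww' mulr1.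
    by field.
  by rewrite !cS; field.
have GK : G (2 ^ N)%N = G 0%N.
  rewrite /G /c natrX divff ?expf_neq0 // mul0r circ0 circ1 //.
have shift : \sum_(j < 2 ^ N) G j.+1 = \sum_(j < 2 ^ N) G j.
  apply: (addrI (G 0%N)); rewrite -[LHS](big_ord_recl (2 ^ N) (fun j => G j)).
  by rewrite big_ord_recr /= GK addrC.
have -> : chain g (fun j => x0 + rh * circ (j%:R / 2 ^+ N)) (2 ^ N) =
    \sum_(j < 2 ^ N) ((w - 1) / 2 * G j + (1 - w') / 2 * G j.+1).
  by apply: eq_bigr => j _; exact: term.
rewrite big_split /= -!mulr_sumr shift.
rewrite sinE; set S := \sum_(_ < _) _.
have -> : dyadic_mean N (fun t => g (x0 + rh * circ t) * (rh * circ t)) = S / 2 ^+ N.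
  by [].
by field; rewrite expf_neq0.
Qed.

(** With u0 = z0 - x and D = f'(z0) - f(z0) / u0, the derivative is D / u0 and the error at z0 + h
    is (rho - D h^2 / u0) / (z0 + h - x), where rho is the error for f. *)
Lemma cdiff_div (f : Cplx R -> Cplx R) (x z0 : Cplx R) :
  z0 != x -> cdiff_at f z0 -> cdiff_at (fun z => f z / (z - x)) z0.
Proof.
move=> zx [d hd]; set u0 := z0 - x.
have u00 : u0 != 0 by rewrite subr_eq0.
have a0 : 0 < cabs u0 by rewrite cabs_gt0.
pose D := (d - f z0 / u0); exists (D / u0) => e e0.
have [del del0 hdel] := hd (e * cabs u0 / 4) (divr_gt0 (mulr_gt0 e0 a0) (ltr0n _ 4)).
have D1 : 0 < cabs D + 1 by rewrite ltr_wpDl ?cabs_ge0.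
(* The second bound keeps [w] at distance at least |u0| / 2 from [x]; the third absorbs the
   quadratic term D h^2 / u0. *)
exists (Num.min del (Num.min (cabs u0 / 2) (e * cabs u0 ^+ 2 / (4 * (cabs D + 1))))).
  by rewrite !lt_min del0 !divr_gt0 ?mulr_gt0 ?exprn_gt0.
move=> w; rewrite !lt_min => /and3P[h1 h2 h3].
set h := w - z0; have {}hdel := hdel _ h1; set rho := (X in cabs X) in hdel.
have ule : cabs u0 / 2 <= cabs (w - x).
  have : cabs (u0 - - h) >= cabs u0 - cabs (- h) by exact: cabs_sub_ge.
  have -> : u0 - - h = w - x by rewrite /u0 /h; ring.
  by rewrite cabsN; move: h2; rewrite -/h; lra.
have wx : w - x != 0 by rewrite -cabs_gt0 (lt_le_trans _ ule) // divr_gt0.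
have -> : f w / (w - x) - f z0 / u0 - D / u0 * h = (rho - D * h ^+ 2 / u0) / (w - x).
  by rewrite /D /rho /h /u0; field; rewrite wx; rewrite subr_eq0 zx.
rewrite cabsM cabsV ler_pdivrMr ?cabs_gt0 //.
apply: (@le_trans _ _ (e * cabs h * (cabs u0 / 2))); last first.
  by rewrite ler_wpM2l // mulr_ge0 ?cabs_ge0 // ltW.
apply: le_trans (cabsB _ _) _.
rewrite [cabs (_ / u0)]cabsM cabsV [cabs (D * _)]cabsM cabsX.
have : cabs D * cabs h ^+ 2 / cabs u0 <= e * cabs u0 / 4 * cabs h.
  rewrite ler_pdivrMr //; have h0 := cabs_ge0 h; have D0 := cabs_ge0 D.
  have : cabs h * (4 * (cabs D + 1)) <= e * cabs u0 ^+ 2.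
    by rewrite -ler_pdivlMr ?mulr_gt0 // ltW.
  move=> H; have : cabs h * (cabs h * (4 * (cabs D + 1))) <= cabs h * (e * cabs u0 ^+ 2).
    by rewrite ler_wpM2l.
  have : 0 <= cabs h * cabs h by rewrite mulr_ge0.
  rewrite !expr2; lra.
by move: hdel; rewrite -/h; lra.
Qed.

(* The circle |z| = r is deformed linearly onto a circle of centre x and radius
   e r; the mean over the latter tends to f x by continuity as e -> 0. *)
Lemma cauchy_formula (f : Cplx R -> Cplx R) (r B : R) (x : Cplx R) :
  0 < r -> (forall z, cabs z <= r -> cdiff_at f z) ->
  (forall z, cabs z <= r -> cabs (f z) <= B) -> cabs x < r ->
  Lam (fun t => f (embc r * circ t) * (embc r * circ t / (embc r * circ t - x))) = f x.
Proof.
move=> r0 df fB xr.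
set phi := (X in Lam X); set rc := embc r.
have crc t : cabs (rc * circ t) = r.
  by rewrite cabsM cabs_circ mulr1 cabs_embc gtr0_norm.
pose phie (e : R) t := f (x + embc e * rc * circ t).
have cerc e t : 0 < e -> cabs (embc e * rc * circ t) = e * r.
  by move=> e0; rewrite -mulrA cabsM crc cabs_embc gtr0_norm.
have xe e t : 0 < e -> cabs x + e * r <= r -> cabs (x + embc e * rc * circ t) <= r.
  by move=> e0 h; rewrite (le_trans (cabsD _ _)) // cerc.
have bphi : bounded_fct phi.
  exists (B * (r / (r - cabs x))) => t; rewrite /phi cabsM -/rc.
  apply: ler_pM; rewrite ?cabs_ge0 //; first by apply: fB; rewrite crc.
  rewrite cabsM cabsV crc ler_pM2l // lef_pV2 ?posrE ?subr_gt0 //.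
    by rewrite -{1}(crc t) cabs_sub_ge.
  rewrite (lt_le_trans _ (cabs_sub_ge _ _)) // crc subr_gt0 //.
have bphie e : 0 < e -> cabs x + e * r <= r -> bounded_fct (phie e).
  by move=> e0 h; exists B => t; apply: fB; apply: xe.
have main e : 0 < e -> e <= 1 -> cabs x + e * r <= r -> Lam phi = Lam (phie e).
  move=> e0 e1 he; apply: Lam_eq; [exact: bphi|exact: bphie|].
  (* s = 1 is the large circle and s = 0 the small one. *)
  pose gam s t := embc s * (rc * circ t) + embc (1 - s) * (x + embc e * rc * circ t).
  pose g z := f z / (z - x).
  have [C C0 hC] := circ_lipschitz.
  have cpos (s : R) : 0 <= s -> cabs (embc s) = s.
    by move=> s0; rewrite cabs_embc ger0_norm.
  move=> eps eps0; have [|||N0 hN0] :=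
    @goursat R g gam (2 * r + cabs x + 2 * r * C) _ _ _ eps eps0.
  - by rewrite ltr_pwDr ?mulr_gt0 // addr_ge0 ?cabs_ge0 ?mulr_ge0 ?(ltW r0).
  - move=> s s' t t' /andP[s0 s1] /andP[s0' s1'] _ _.
    have -> : gam s t - gam s' t' =
       embc (s - s') * (rc * circ t - (x + embc e * rc * circ t)) +
       (embc s' * rc + embc (1 - s') * (embc e * rc)) * (circ t - circ t').
      by rewrite /gam !embcB !embc1; ring.
    rewrite (le_trans (cabsD _ _)) // cabsM cabs_embc.
    have h1 : cabs (rc * circ t - (x + embc e * rc * circ t)) <= 2 * r + cabs x.
      rewrite (le_trans (cabsB _ _)) // crc.
      have := cabsD x (embc e * rc * circ t); rewrite cerc //.
      have : e * r <= r by rewrite ler_piMl // ltW.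
      by lra.
    have h2 : cabs ((embc s' * rc + embc (1 - s') * (embc e * rc)) * (circ t - circ t'))
        <= 2 * r * (C * `|t - t'|).
      rewrite cabsM ler_pM ?cabs_ge0 // (le_trans (cabsD _ _)) //.
      rewrite !cabsM !cabs_embc !ger0_norm ?subr_ge0 ?(ltW e0) ?(ltW r0) //.
      have : s' * r <= r by rewrite ler_piMl // ltW.
      have : (1 - s') * (e * r) <= r.
        by rewrite mulrA ler_piMl ?(ltW r0) // mulr_ile1 ?subr_ge0 ?(ltW e0) //; lra.
      by lra.
    have h3 : `|s - s'| * cabs (rc * circ t - (x + embc e * rc * circ t)) <=
       `|s - s'| * (2 * r + cabs x) by rewrite ler_wpM2l.
    apply: le_trans (lerD h3 h2) _.
    rewrite -[in leRHS]addrA mulrDr mulrDl [in leRHS]mulrDl.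
    have : 0 <= 2 * r * C * `|s - s'| by rewrite !mulr_ge0 // ltW.
    have : 0 <= (2 * r + cabs x) * `|t - t'|.
      by rewrite mulr_ge0 // addr_ge0 ?cabs_ge0 // mulr_ge0 // ltW.
    by lra.
  (* The deformation avoids [x]: |gam s t - x| is at least (s + (1 - s) e) r - s |x|, which is
     positive since |x| < r and e > 0. *)
  - move=> s t /andP[s0 s1] _; apply: cdiff_div.
      rewrite -subr_eq0 -cabs_gt0.
      have -> : gam s t - x = (embc s + embc (1 - s) * embc e) * rc * circ t - embc s * x.
        by rewrite /gam !embcB !embc1; ring.
      rewrite (lt_le_trans _ (cabs_sub_ge _ _)) //.
      have -> : cabs ((embc s + embc (1 - s) * embc e) * rc * circ t) = (s + (1 - s) * e) * r.
        rewrite -mulrA cabsM crc -embcM -embcD cabs_embc ger0_norm //.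
        by rewrite addr_ge0 // mulr_ge0 ?subr_ge0 // ltW.
      rewrite [cabs (_ * x)]cabsM cpos //.
      have [->|sp] := eqVneq s 0.
        by rewrite subr0 !mul0r subr0 add0r mul1r mulr_gt0.
      have sp' : 0 < s by rewrite lt_def sp.
      have : 0 < s * (r - cabs x) by rewrite mulr_gt0 ?subr_gt0.
      have : 0 <= (1 - s) * e * r by rewrite !mulr_ge0 ?subr_ge0 // ltW.
      by lra.
    apply: df; rewrite (le_trans (cabsD _ _)) // !cabsM -cabsM crc !cabs_embc.
    rewrite !ger0_norm ?subr_ge0 //.
    have : (1 - s) * cabs (x + embc e * rc * circ t) <= (1 - s) * r.
      by rewrite ler_wpM2l ?subr_ge0 // xe.
    by lra.
  (* From N = 2 on, [sin_dyadic_ge] bounds the common factor 2^N |sin(2 pi / 2^N)| below by 4, so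
     smallness of the contour sum passes to the difference of the means. *)
  exists (maxn 2 N0) => N; rewrite geq_max => /andP[N2 NN0].
  have := hN0 N NN0; rewrite /box /=.
  have K1 : (0 + 2 ^ N)%:R / 2 ^+ N = 1 :> R.
    by rewrite add0n natrX divff // expf_neq0.
  (* The sides t = 0 and t = 1 have the same image since [circ 0] and [circ 1] agree; they cancel,
     and the two circles remain. *)
  have -> : (fun i : nat => gam ((0 + i)%:R / 2 ^+ N) ((0 + 2 ^ N)%:R / 2 ^+ N)) =
       (fun i : nat => gam ((0 + i)%:R / 2 ^+ N) (0%:R / 2 ^+ N)).
    by apply: funext => i; rewrite K1 mul0r /gam circ0 circ1.
  rewrite K1 [X in X - _ - _]addrC addrK.
  have -> : (fun i : nat => gam 1 ((0 + i)%:R / 2 ^+ N)) =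
      (fun i : nat => 0 + rc * circ (i%:R / 2 ^+ N)).
    by apply: funext => i; rewrite add0n /gam subrr mul0r addr0 mul1r add0r.
  have -> : (fun i : nat => gam (0%:R / 2 ^+ N) ((0 + i)%:R / 2 ^+ N)) =
      (fun i : nat => x + embc e * rc * circ (i%:R / 2 ^+ N)).
    by apply: funext => i; rewrite add0n mul0r /gam mul0r add0r subr0 mul1r.
  rewrite !chain_circ -mulrBr.
  have -> : (fun t => g (0 + rc * circ t) * (rc * circ t)) = phi.
    by apply: funext => t; rewrite /g /phi add0r -/rc mulrAC -mulrA.
  have -> : (fun t => g (x + embc e * rc * circ t) * (embc e * rc * circ t)) = phie e.
    apply: funext => t; rewrite /g /phie addrAC subrr add0r divfK //.
    by rewrite -cabs_gt0 cerc // mulr_gt0.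
  rewrite !cabsM cabsX cabs_nat.
  have -> : cabs (mkc 0 (sin (pi *+ 2 * (1 / 2 ^+ N) : R))) = `|sin (pi *+ 2 * (1 / 2 ^+ N))|.
    by rewrite mkcE add0r cabsM cabs_i mul1r cabs_embc.
  case: N N2 {NN0 K1} => [|[|N]] // _; have h4 := sin_dyadic_ge N.
  set A := cabs (_ - _); have A0 : 0 <= A by exact: cabs_ge0.
  rewrite [`|_| * _]mulrC; set W := _ * `|_| in h4 *.
  have : 4 * A <= W * A by rewrite ler_wpM2r.
  by lra.
apply/eqP; rewrite -subr_eq0 -cabs_eq0 eq_le cabs_ge0 andbT.
apply/ler_addgt0Pl => eta eta0; rewrite addr0.
have [d /(_ 1 ltr01)[del del0 hdel]] := df x (ltW xr).
have d1 : 0 < cabs d + 1 by rewrite ltr_wpDl ?cabs_ge0.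
(* The first two bounds keep the small circle inside the disk, the third puts it within [del] of
   [x], and the last makes |f - f x| <= (|d| + 1) e r <= eta on it. *)
pose e := Num.min (Num.min 1 ((r - cabs x) / r))
   (Num.min (del / (2 * r)) (eta / ((cabs d + 1) * r))).
have e0 : 0 < e by rewrite !lt_min ltr01 !divr_gt0 ?subr_gt0 ?mulr_gt0.
have [[e1 e2] [e3 e4]] : (e <= 1 /\ e * r <= r - cabs x) /\
    (e * (2 * r) <= del /\ e * ((cabs d + 1) * r) <= eta).
  split; split; rewrite -?ler_pdivlMr ?mulr_gt0 //; rewrite /e ge_min;
    by rewrite !ge_min lexx ?orbT.
have he : cabs x + e * r <= r by lra.
rewrite (main e) // -(Lam_cst (f x)) -mean_functionalB; first last.
- by exists (cabs (f x)).
- exact: bphie.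
- exact: Lam_mean.
have [_ bnd] := Lam_mean R; apply: bnd => t; rewrite /phie.
have := hdel (x + embc e * rc * circ t); rewrite addrAC subrr add0r cerc //.
have er : e * r < del by have := mulr_gt0 e0 r0; lra.
move=> /(_ er) h.
set A := f _ - f x in h *; set b := d * _ in h.
have : cabs A <= cabs (A - b) + cabs b by rewrite -{1}(subrK b A) cabsD.
have : cabs b = cabs d * (e * r) by rewrite cabsM cerc.
by lra.
Qed.

End Circle.

(** * First-order expansion of powers of a resolvent *)

Section KernelTaylor.
Variable R : realType.

(** Meant for u = 1 / (z - xi - h) and v = 1 / (z - xi), which satisfy the resolvent identity u - v
    = h u v. The constant depends only on [b] and [B], hence is uniform in z on the circle. *)
Lemma expr_resolvent_taylor (b : nat) (B : R) : 0 <= B ->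
  exists2 C : R, 0 <= C & forall u v h : Cplx R, cabs u <= B -> cabs v <= B ->
    u - v = h * u * v ->
    cabs (u ^+ b - v ^+ b - b%:R * h * v ^+ b.+1) <= C * cabs h ^+ 2.
Proof.
move=> B0; elim: b => [|b [C C0 IH]].
  by exists 0 => // u v h _ _ _; rewrite !expr0 subrr !mul0r subr0 cabs0.
exists (B * C + b.+1%:R * B ^+ b.+3).
  by apply: addr_ge0; apply: mulr_ge0 => //; exact: exprn_ge0.
move=> u v h uB vB E; have {}IH := IH u v h uB vB E.
have -> : u ^+ b.+1 - v ^+ b.+1 - b.+1%:R * h * v ^+ b.+2 =
  u * (u ^+ b - v ^+ b - b%:R * h * v ^+ b.+1) + b.+1%:R * (h ^+ 2 * (u * v ^+ b.+2)).
  have E1 : u * v ^+ b = v ^+ b.+1 + h * u * v ^+ b.+1.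
    by rewrite exprS mulrA -E; ring.
  have E2 : u * v ^+ b.+1 = v ^+ b.+2 + h * u * v ^+ b.+2.
    by rewrite 2!exprS [in RHS]exprS !mulrA -E; ring.
  rewrite -natr1 [in LHS]exprS.
  have -> : u * (u ^+ b - v ^+ b - b%:R * h * v ^+ b.+1) =
     u * u ^+ b - u * v ^+ b - b%:R * h * (u * v ^+ b.+1) by ring.
  have E3 : h * u * v ^+ b.+1 = h * (u * v ^+ b.+1) by ring.
  by rewrite E1 E3 E2; ring.
rewrite (le_trans (cabsD _ _)) // mulrDl lerD //.
  by rewrite cabsM -[leRHS]mulrA ler_pM ?cabs_ge0.
rewrite cabsM cabs_nat -mulrA ler_wpM2l // cabsM cabsX [leRHS]mulrC.
rewrite ler_wpM2l ?exprn_ge0 ?cabs_ge0 // cabsM cabsX [B ^+ _]exprS.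
apply: ler_pM => //; rewrite ?exprn_ge0 ?cabs_ge0 //.
by apply: lerXn2r; rewrite ?nnegrE ?cabs_ge0.
Qed.

End KernelTaylor.

(** * Cauchy's formula and estimates on a polydisk *)

Section CauchyEstimates.
Variables (R : realType) (m : nat) (Rd : 'I_m -> R) (f : 'rV[Cplx R]_m -> Cplx R).
Variable mu : R.
Implicit Types (x y : 'rV[Cplx R]_m) (th : 'I_m -> R) (s : seq 'I_m).

Definition upd x (i : 'I_m) (t : Cplx R) : 'rV[Cplx R]_m :=
  \row_j (if j == i then t else x 0 j).

Hypothesis Rd0 : forall i, 0 < Rd i.
Hypothesis fdiff : forall x i, (forall j, cabs (x 0 j) <= Rd j) ->
  cdiff_at (fun t => f (upd x i t)) (x 0 i).
Hypothesis fmu : forall x, (forall j, cabs (x 0 j) <= Rd j) -> cabs (f x) <= mu.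

Definition thupd th (i : 'I_m) (t : R) : 'I_m -> R :=
  fun j => if j == i then t else th j.

Definition torus_coord (i : 'I_m) (t : R) : Cplx R := embc (Rd i) * circ t.

Definition torus_pt th : 'rV[Cplx R]_m := \row_j torus_coord j (th j).

Definition LamI (i : 'I_m) (phi : ('I_m -> R) -> Cplx R) : ('I_m -> R) -> Cplx R :=
  fun th => Lam (fun t => phi (thupd th i t)).

(** The value at [th] depends only on the coordinates outside [s]. *)
Definition LamS s (phi : ('I_m -> R) -> Cplx R) := foldr LamI phi s.

Lemma cabs_torus_coord i t : cabs (torus_coord i t) = Rd i.
Proof. by rewrite cabsM cabs_circ mulr1 cabs_embc gtr0_norm. Qed.

Lemma LamS_le s phi B : (forall th, cabs (phi th) <= B) ->
  forall th, cabs (LamS s phi th) <= B.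
Proof.
move=> hB; elim: s => [//|i s IH] th /=.
by have [_ bnd] := Lam_mean R; apply: bnd => t; exact: IH.
Qed.

Lemma LamS_mean s th : mean_functional (fun phi => LamS s phi th).
Proof.
split=> [phi psi a b [B hB] [B' hB']|phi B hB]; last exact: LamS_le.
elim: s th => [//|i s IH] th /=.
have [lin _] := Lam_mean R; rewrite /LamI -lin.
- by congr Lam; apply: funext => t; exact: IH.
- by exists B => t; apply: LamS_le.
- by exists B' => t; apply: LamS_le.
Qed.

Definition kern (i : 'I_m) (a : nat) (xi : Cplx R) (t : R) : Cplx R :=
  torus_coord i t / (torus_coord i t - xi) ^+ a.+1.

Lemma torus_sub_ge i t (xi : Cplx R) : Rd i - cabs xi <= cabs (torus_coord i t - xi).
Proof. by rewrite -{1}(cabs_torus_coord i t) cabs_sub_ge. Qed.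

Lemma torus_inv_le i t (xi : Cplx R) : cabs xi < Rd i ->
  cabs (torus_coord i t - xi)^-1 <= (Rd i - cabs xi)^-1.
Proof.
move=> h; rewrite cabsV lef_pV2 ?posrE ?subr_gt0 ?torus_sub_ge //.
by rewrite (lt_le_trans _ (torus_sub_ge _ _ _)) ?subr_gt0.
Qed.

Lemma kern_le i a (xi : Cplx R) t : cabs xi < Rd i ->
  cabs (kern i a xi t) <= Rd i / (Rd i - cabs xi) ^+ a.+1.
Proof.
move=> h; rewrite /kern cabsM cabs_torus_coord ler_wpM2l ?(ltW (Rd0 i)) //.
rewrite -!exprVn cabsX lerXn2r ?torus_inv_le // nnegrE ?cabs_ge0 //.
by rewrite invr_ge0 subr_ge0 ltW.
Qed.

Definition integrand (alpha : 'I_m -> nat) x th : Cplx R :=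
  f (torus_pt th) * \prod_j kern j (alpha j) (x 0 j) (th j).

(* (2 i pi)^-m times the integral of f(z) / prod_j (z_j - x_j)^(alpha_j + 1)
   over the torus |z_j| = Rd j; kern absorbs dz_j = 2 i pi z_j dt_j. *)
Definition cauchy_int (alpha : 'I_m -> nat) x : Cplx R :=
  LamS (enum 'I_m) (integrand alpha x) (fun=> 0).

Let open_pd x := forall j, cabs (x 0 j) < Rd j.

Lemma f_torus_le th : cabs (f (torus_pt th)) <= mu.
Proof. by apply: fmu => j; rewrite mxE cabs_torus_coord. Qed.

Lemma mu_ge0 : 0 <= mu.
Proof. exact: le_trans (cabs_ge0 _) (f_torus_le (fun=> 0)). Qed.

Lemma integrand_bounded alpha x : open_pd x -> bounded_fct (integrand alpha x).
Proof.
move=> hx; exists (mu * \prod_j (Rd j / (Rd j - cabs (x 0 j)) ^+ (alpha j).+1)) => th.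
rewrite cabsM cabs_prod ler_pM ?cabs_ge0 ?f_torus_le ?prodr_ge0 //.
  by move=> j _; exact: cabs_ge0.
by apply: ler_prod => j _; rewrite cabs_ge0 kern_le.
Qed.

(** The coordinates in [s] have already been integrated out and replaced by those of [x]; the others
    still run over the torus. *)
Definition mix s th x : 'rV[Cplx R]_m :=
  \row_j (if j \in s then x 0 j else torus_coord j (th j)).

(** Each step applies the one-variable formula in the coordinate at the head of the list; the
    kernels of the coordinates outside the list are constant for that mean and are taken out of
    it. *)
Lemma cauchy_iter s x th : uniq s -> open_pd x ->
  LamS s (integrand (fun=> 0%N) x) th =
  f (mix s th x) * \prod_(j | j \notin s) kern j 0 (x 0 j) (th j).
Proof.
move=> us hx; elim: s us th => [_ th|i s IH /andP[iNs us] th] /=.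
  rewrite /integrand; congr (f _ * _); apply/rowP => j; by rewrite !mxE.
rewrite /LamI; under eq_fun do rewrite IH //.
set y := mix (i :: s) th x.
pose c := \prod_(j | j \notin i :: s) kern j 0 (x 0 j) (th j).
pose psi (t : R) := f (upd y i (torus_coord i t)) * kern i 0 (x 0 i) t.
have yle j : cabs (y 0 j) <= Rd j.
  by rewrite mxE; case: ifP => _; rewrite ?cabs_torus_coord ?(ltW (hx j)).
have updle z : cabs z <= Rd i -> forall j, cabs (upd y i z 0 j) <= Rd j.
  by move=> hz j; rewrite mxE; case: eqP => [->|_].
have -> : (fun t => f (mix s (thupd th i t) x) *
    \prod_(j | j \notin s) kern j 0 (x 0 j) (thupd th i t j)) = (fun t => c * psi t).
  apply: funext => t; rewrite (bigD1 i) //= /psi /thupd eqxx.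
  rewrite [RHS]mulrC -[RHS]mulrA; congr (f _ * (_ * _)).
    apply/rowP => j; rewrite !mxE inE; have [->|ji] := eqVneq j i.
      by rewrite (negbTE iNs).
    by case: ifP.
  rewrite /c; under [in RHS]eq_bigl => j do rewrite inE negb_or andbC.
  by apply: eq_bigr => j /andP[_ /negbTE ->].
rewrite (mean_functionalZ _ (Lam_mean R)); last first.
  exists (mu * (Rd i / (Rd i - cabs (x 0 i)) ^+ 1)) => t.
  rewrite /psi cabsM ler_pM ?cabs_ge0 ?kern_le //.
  by apply/fmu/updle; rewrite cabs_torus_coord.
have -> : Lam psi = f y.
  rewrite /psi /kern; have -> : f y = f (upd y i (x 0 i)).
    congr f; apply/rowP => j; rewrite !mxE inE.
    by have [->|] := eqVneq j i.
  apply: (@cauchy_formula R (fun z => f (upd y i z)) (Rd i) mu) => //.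
    move=> z hz; have := fdiff i (updle z hz); rewrite mxE eqxx.
    suff -> : (fun t => f (upd (upd y i z) i t)) = (fun t => f (upd y i t)) by [].
    by apply: funext => t; congr f; apply/rowP => j; rewrite !mxE; case: eqP.
  by move=> z hz; exact/fmu/updle.
by rewrite mulrC.
Qed.

Lemma cauchy_int0 x : open_pd x -> cauchy_int (fun=> 0%N) x = f x.
Proof.
move=> hx; rewrite /cauchy_int cauchy_iter ?enum_uniq // big1 ?mulr1.
  by congr f; apply/rowP => j; rewrite !mxE mem_enum.
by move=> j; rewrite mem_enum.
Qed.

(** For |h| at most half of Rd i - |xi|, both resolvents are bounded by 2 / (Rd i - |xi|) for every
    [t], so the remainder is uniform on the circle. *)
Lemma kern_taylor i a (xi : Cplx R) : cabs xi < Rd i ->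
  exists2 C : R, 0 <= C & forall h t, cabs h <= (Rd i - cabs xi) / 2 ->
   cabs (kern i a (xi + h) t - kern i a xi t - a.+1%:R * h * kern i a.+1 xi t)
     <= C * cabs h ^+ 2.
Proof.
move=> hxi; have d0 : 0 < Rd i - cabs xi by rewrite subr_gt0.
have [C C0 hC] := @expr_resolvent_taylor R a.+1 (2 / (Rd i - cabs xi))
  (divr_ge0 (ler0n _ 2) (ltW d0)).
exists (Rd i * C); first by rewrite mulr_ge0 // ltW.
move=> h t hh; set z := torus_coord i t.
have hxih : cabs (xi + h) <= cabs xi + (Rd i - cabs xi) / 2.
  by rewrite (le_trans (cabsD _ _)) // lerD.
have lt1 : cabs (xi + h) < Rd i by apply: le_lt_trans hxih _; lra.
have zx : z - xi != 0.
  by rewrite -cabs_gt0 (lt_le_trans _ (torus_sub_ge _ _ _)).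
have zxh : z - (xi + h) != 0.
  by rewrite -cabs_gt0 (lt_le_trans _ (torus_sub_ge _ _ _)) ?subr_gt0.
have -> : kern i a (xi + h) t - kern i a xi t - a.+1%:R * h * kern i a.+1 xi t =
  z * ((z - (xi + h))^-1 ^+ a.+1 - (z - xi)^-1 ^+ a.+1
       - a.+1%:R * h * (z - xi)^-1 ^+ a.+2).
  by rewrite /kern -/z !exprVn; ring.
rewrite cabsM cabs_torus_coord -[leRHS]mulrA ler_wpM2l ?(ltW (Rd0 i)) //; apply: hC.
- apply: le_trans (torus_inv_le _ lt1) _; rewrite -[2]invrK -invfM.
  by rewrite lef_pV2 ?posrE ?subr_gt0 ?mulr_gt0 ?invr_gt0 //; lra.
- apply: le_trans (torus_inv_le _ hxi) _.
  by rewrite ler_peMl ?invr_ge0 ?(ltW d0) // ler1n.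
- by field; rewrite zx zxh.
Qed.

Lemma mean_functional3 (T : Type) (F : (T -> Cplx R) -> Cplx R) p1 p2 p3 c :
  mean_functional F -> bounded_fct p1 -> bounded_fct p2 -> bounded_fct p3 ->
  F p1 - F p2 - c * F p3 = F (fun t => p1 t - p2 t - c * p3 t).
Proof.
move=> hF h1 h2 h3.
have b12 : bounded_fct (fun t => p1 t - p2 t).
  case: h1 h2 => [B hB] [B' hB']; exists (B + B') => t.
  by rewrite (le_trans (cabsB _ _)) // lerD.
have b3 : bounded_fct (fun t => c * p3 t).
  by case: h3 => [B hB]; exists (cabs c * B) => t; rewrite cabsM ler_wpM2l ?cabs_ge0.
by rewrite (mean_functionalB hF b12 b3) (mean_functionalB hF h1 h2) mean_functionalZ.
Qed.

Definition incr (alpha : 'I_m -> nat) (i : 'I_m) : 'I_m -> nat :=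
  fun j => if j == i then (alpha j).+1 else alpha j.

Lemma shift_upd x i h : h *: delta_mx 0 i + x = upd x i (x 0 i + h).
Proof.
apply/rowP => j; rewrite !mxE eqxx /=; case: eqP => [->|_].
  by rewrite mulr1 addrC.
by rewrite mulr0 add0r.
Qed.

(** Only the kernel of coordinate [i] moves. Its expansion is uniform on the torus, so a functional
    of norm at most one preserves the remainder estimate. *)
Lemma cauchy_int_taylor alpha x i : open_pd x ->
  exists2 C : R, 0 <= C & forall h, cabs h <= (Rd i - cabs (x 0 i)) / 2 ->
    open_pd (upd x i (x 0 i + h)) /\
    cabs (cauchy_int alpha (upd x i (x 0 i + h)) - cauchy_int alpha x
      - (alpha i).+1%:R * h * cauchy_int (incr alpha i) x) <= C * cabs h ^+ 2.
Proof.
move=> hx; have [C C0 hC] := kern_taylor (alpha i) (hx i).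
pose Pi := \prod_(j | j != i) (Rd j / (Rd j - cabs (x 0 j)) ^+ (alpha j).+1).
have Pi0 : 0 <= Pi.
  apply: prodr_ge0 => j _; rewrite divr_ge0 ?exprn_ge0 ?(ltW (Rd0 _)) //.
  by rewrite subr_ge0 ltW.
exists (mu * Pi * C); first by rewrite !mulr_ge0 ?mu_ge0.
move=> h hh; have hxh : open_pd (upd x i (x 0 i + h)).
  move=> j; rewrite mxE; case: eqP => [->|//].
  apply: le_lt_trans (cabsD _ _) _; have := hx i; lra.
split=> //; rewrite /cauchy_int.
have /= -> := @mean_functional3 _ (fun phi => LamS (enum 'I_m) phi (fun=> 0))
  (integrand alpha (upd x i (x 0 i + h))) (integrand alpha x)
  (integrand (incr alpha i) x) ((alpha i).+1%:R * h) (LamS_mean _ _)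
  (integrand_bounded _ hxh) (integrand_bounded _ hx) (integrand_bounded _ hx).
apply: LamS_le => th; rewrite /integrand.
pose P := \prod_(j | j != i) kern j (alpha j) (x 0 j) (th j).
have -> : \prod_j kern j (alpha j) (upd x i (x 0 i + h) 0 j) (th j) =
    kern i (alpha i) (upd x i (x 0 i + h) 0 i) (th i) * P.
  rewrite (bigD1 i isT) /=; apply/congr1/eq_bigr => j /negbTE ji.
  by rewrite mxE ji.
have -> : \prod_j kern j (alpha j) (x 0 j) (th j) =
    kern i (alpha i) (x 0 i) (th i) * P by rewrite (bigD1 i).
have -> : \prod_j kern j (incr alpha i j) (x 0 j) (th j) =
    kern i (alpha i).+1 (x 0 i) (th i) * P.
  rewrite (bigD1 i isT) /= {1}/incr eqxx; apply/congr1/eq_bigr => j /negbTE ji.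
  by rewrite /incr ji.
set F := f _.
rewrite mxE eqxx; set k1 := kern _ _ _ _; set k2 := kern _ _ _ _.
set k3 := kern _ _ _ _.
have -> : F * (k1 * P) - F * (k2 * P) - (alpha i).+1%:R * h * (F * (k3 * P)) =
   F * P * (k1 - k2 - (alpha i).+1%:R * h * k3) by ring.
rewrite cabsM -[leRHS]mulrA ler_pM ?cabs_ge0 ?hC // cabsM ler_pM ?cabs_ge0 ?f_torus_le //.
rewrite cabs_prod; apply: ler_prod => j /negbTE ji.
by rewrite cabs_ge0 kern_le.
Qed.

(** The conclusion again has the form of the hypothesis on [G], so the lemma can be iterated.
    Knowing [G] on the open polydisk is enough, since small increments stay inside it. *)
Lemma partial_cauchy_int alpha i (G : 'rV[Cplx R]_m -> Cplx R) (c : Cplx R) :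
  (forall x, open_pd x -> G x = c * cauchy_int alpha x) ->
  forall x, open_pd x ->
    partial i G x = c * (alpha i).+1%:R * cauchy_int (incr alpha i) x.
Proof.
move=> hG x hx; rewrite /partial /derive; apply: cvg_lim; first exact: norm_hausdorff.
have [C C0 hC] := cauchy_int_taylor alpha i hx.
apply/cvg_cabsP => e e0.
have d0 : 0 < (Rd i - cabs (x 0 i)) / 2 by rewrite divr_gt0 ?subr_gt0.
pose K := cabs c * C + 1.
have K0 : 0 < K by rewrite ltr_wpDl // mulr_ge0 ?cabs_ge0.
pose del := Num.min ((Rd i - cabs (x 0 i)) / 2) (e / K).
have del0 : 0 < embc del by rewrite (ltr_embc 0) lt_min d0 divr_gt0.
apply: filterS2 (dnbhs0_lt del0) (nbhs_dnbhs_neq 0) => h.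
rewrite normE ltr_embc lt_min => /andP[h1 h2] hn0.
rewrite /= shift_upd /GRing.scale /=; have [hp ht] := hC h (ltW h1).
rewrite (hG _ hp) (hG _ hx).
set A := cauchy_int _ (upd _ _ _) in ht *; set A0 := cauchy_int _ x in ht *.
set A1 := cauchy_int _ x in ht *.
have -> : c * (alpha i).+1%:R * A1 - h^-1 * (c * A - c * A0) =
   - (c * (A - A0 - (alpha i).+1%:R * h * A1) / h) by field.
have h0 : 0 < cabs h by rewrite cabs_gt0.
rewrite cabsN cabsM cabsM cabsV ltr_pdivrMr //.
apply: (@le_lt_trans _ _ (cabs c * (C * cabs h ^+ 2))).
  by rewrite ler_wpM2l ?cabs_ge0.
rewrite expr2 !mulrA ltr_pM2r //.
move: h2; rewrite ltr_pdivlMr // /K; have := cabs_ge0 h; lra.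
Qed.

(** Since [s] has no repetition, the exponent of a coordinate starts at 0 when its turn comes, and
    the factors a + 1 collected on the way multiply to a factorial. *)
Lemma partials_cauchy_int (alpha : 'I_m -> nat) s x : uniq s -> open_pd x ->
  foldr (fun i g => iter (alpha i) (partial i) g) f s x =
  (\prod_(i <- s) (alpha i)`!)%:R *
    cauchy_int (fun j => if j \in s then alpha j else 0%N) x.
Proof.
move=> us; elim: s us x => [_ x hx|i s IH /andP[iNs us] x hx] /=.
  by rewrite big_nil mul1r cauchy_int0.
pose c : Cplx R := (\prod_(i <- s) (alpha i)`!)%:R.
pose beta a j := if j == i then a else if j \in s then alpha j else 0%N.
have iterE a : forall y, open_pd y ->
    iter a (partial i) (foldr (fun i g => iter (alpha i) (partial i) g) f s) y =
    c * a`!%:R * cauchy_int (beta a) y.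
  elim: a => [y hy|a IHa y hy] /=.
    rewrite IH // mulr1; congr (_ * cauchy_int _ _); apply: funext => j.
    by rewrite /beta; case: eqP => [->|//]; rewrite (negbTE iNs).
  rewrite (partial_cauchy_int i IHa hy) /beta eqxx -[c * _ * _]mulrA -natrM mulnC -factS.
  congr (_ * cauchy_int _ _); apply: funext => j; rewrite /incr.
  by case: eqP.
rewrite iterE // big_cons natrM [_ * c]mulrC; congr (_ * cauchy_int _ _).
by apply: funext => j; rewrite /beta inE; case: eqP => [->|].
Qed.

(** At the origin the factorials cancel and the kernel of coordinate i has constant modulus (Rd
    i)^(- alpha i). *)
Lemma taylor_coef_cauchy (alpha : 'I_m -> nat) :
  cabs (taylor_coef f alpha) <= mu * \prod_i (Rd i)^-1 ^+ alpha i.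
Proof.
have h0 : open_pd 0 by move=> j; rewrite mxE cabs0.
rewrite /taylor_coef /partials partials_cauchy_int ?enum_uniq // big_enum /=.
set c := (\prod_(_ < _) _)%:R.
have c0 : c != 0 :> Cplx R.
  rewrite pnatr_eq0 -lt0n prodn_gt0 // => i; exact: fact_gt0.
rewrite mulrAC divff // mul1r; apply: LamS_le => th.
rewrite cabsM ler_pM ?cabs_ge0 ?f_torus_le // cabs_prod; apply: ler_prod => j _.
rewrite cabs_ge0 mem_enum mxE /kern subr0 cabsM cabsV cabsX cabs_torus_coord exprS.
by rewrite invfM mulrA divff ?mul1r ?exprVn ?lexx // gt_eqF.
Qed.

End CauchyEstimates.

(** * From Frechet differentiability to differentiability in each coordinate *)

Section Holomorphic.
Variables (R : realType) (m : nat).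

Lemma differentiable_cdiff (f : 'rV[Cplx R]_m -> Cplx R) (x : 'rV[Cplx R]_m)
    (i : 'I_m) :
  differentiable f x -> cdiff_at (fun t => f (upd x i t)) (x 0 i).
Proof.
move=> /(@diff_derivable _ _ _ f x (delta_mx 0 i)) /cvg_ex[d /cvg_cabsP hd].
have updx : upd x i (x 0 i) = x.
  by apply/rowP => j; rewrite mxE; case: eqP => [->|].
exists d => e e0; have := hd e e0; rewrite /dnbhs near_withinE.
move=> /nbhs_norm0P[E /= E0 hE].
have [EE re0] : E = embc (complex.Re E) /\ 0 < complex.Re E.
  move: E0; rewrite ltcE => /andP[/eqP /= im0 /= re0]; split=> //.
  by apply/eqP; rewrite eq_complex /= im0 !eqxx.
exists (complex.Re E) => // w hw; rewrite updx.
have [->|wn] := eqVneq w (x 0 i).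
  by rewrite updx !subrr mulr0 subr0 cabs0 mulr0.
have h0 : w - x 0 i != 0 by rewrite subr_eq0.
have := hE (w - x 0 i); rewrite /= normE EE ltr_embc => /(_ hw h0).
rewrite shift_upd [x 0 i + _]addrC subrK /GRing.scale /=.
set h := w - x 0 i in h0 *; set D := f _ - f x => hlt.
have -> : D - d * h = - ((d - h^-1 * D) * h) by field.
by rewrite cabsN cabsM ler_wpM2r ?cabs_ge0 // ltW.
Qed.

Lemma taylor_coef_le (Rd : 'I_m -> R) (f : 'rV[Cplx R]_m -> Cplx R) (mu : R)
    (alpha : 'I_m -> nat) :
  (forall i, 0 < Rd i) ->
  holomorphic_near [set x : 'rV[Cplx R]_m | forall j, cabs (x 0 j) <= Rd j] f ->
  (forall x : 'rV[Cplx R]_m, (forall j, cabs (x 0 j) <= Rd j) -> cabs (f x) <= mu) ->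
  cabs (taylor_coef f alpha) <= mu * \prod_i (Rd i)^-1 ^+ alpha i.
Proof.
move=> Rd0 [U [_ sub df]] fmu; apply: taylor_coef_cauchy => // x i hx.
exact/differentiable_cdiff/df/sub.
Qed.

End Holomorphic.

(** * Truncated weighted norms of formal power series *)

Section WeightedNorm.
Variables (R : realType) (x : R) (m : nat).
Hypothesis x0 : 0 <= x.
Implicit Types a b : fps R.

(** The majorant series cut at degree [m], so that norms are finite before any convergence is
    known. *)
Definition wnorm a : R := \sum_(j < m.+1) cabs (a j) * x ^+ j.

Lemma wnorm_term_ge0 a j : 0 <= cabs (a j) * x ^+ j.
Proof. by rewrite mulr_ge0 ?cabs_ge0 ?exprn_ge0. Qed.

Lemma wnorm_ge0 a : 0 <= wnorm a.
Proof. by apply: sumr_ge0 => j _; exact: wnorm_term_ge0. Qed.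

(** The left side is bounded by the sum over pairs of degrees with total at most [m]; the right side
    has all pairs of degrees at most [m]. *)
Lemma wnorm_mul a b : wnorm (fps_mul a b) <= wnorm a * wnorm b.
Proof.
pose A i := cabs (a i) * x ^+ i; pose B i := cabs (b i) * x ^+ i.
have B0 i : 0 <= B i by exact: wnorm_term_ge0.
have A0 i : 0 <= A i by exact: wnorm_term_ge0.
apply: (@le_trans _ _ (\sum_(j < m.+1) \sum_(i < m.+1 | (i < j.+1)%N) A i * B (j - i)%N)).
  apply: ler_sum => j _.
  rewrite -(big_ord_widen m.+1 (fun i => A i * B (j - i)%N)) ?ltn_ord //.
  rewrite /fps_mul; apply: le_trans (ler_wpM2r _ (cabs_sum _ _ _)) _.
    exact: exprn_ge0.
  rewrite mulr_suml ler_sum // => i _.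
  by rewrite cabsM /A /B mulrACA -exprD subnKC // -ltnS.
rewrite (exchange_big_dep xpredT) //= mulr_suml; apply: ler_sum => i _.
rewrite -mulr_sumr ler_wpM2l //.
rewrite -(big_mkord (fun j => (i < j.+1)%N) (fun j => B (j - i)%N)).
have -> : wnorm b = \sum_(0 <= l < m.+1) B l by rewrite big_mkord.
rewrite -(big_nat_widenl i 0 m.+1 xpredT) //.
rewrite -{1}[nat_of_ord i]add0n big_addn.
under eq_bigr do rewrite addnK.
rewrite [leRHS](big_cat_nat (n := m.+1 - i)) ?leq_subr //=.
by rewrite lerDl sumr_ge0.
Qed.

Lemma wnorm_one : wnorm (@fps_one R) <= 1.
Proof.
rewrite /wnorm big_ord_recl /fps_one /= cabs1 expr0 mulr1 big1 ?addr0 //.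
by move=> j _; rewrite cabs0 mul0r.
Qed.

Lemma wnorm_exp a e : wnorm (fps_exp a e) <= wnorm a ^+ e.
Proof.
elim: e => [|e IH]; first exact: wnorm_one.
by rewrite exprS (le_trans (wnorm_mul _ _)) // ler_wpM2l ?wnorm_ge0.
Qed.

Lemma wnorm_prod M (G : 'I_M -> fps R) :
  wnorm (\big[@fps_mul R/@fps_one R]_(i < M) G i) <= \prod_(i < M) wnorm (G i).
Proof.
elim/big_rec2: _ => [|i p q _ le]; first exact: wnorm_one.
by rewrite (le_trans (wnorm_mul _ _)) // ler_wpM2l ?wnorm_ge0.
Qed.

(** The range of exponents in [fps_subst] varies with the degree j; this moves all degrees to one
    common index set, so that the two sums can be exchanged. *)
Lemma sum_ffun_widen M j (P : pred {ffun 'I_M -> 'I_j.+1}) (h : ('I_M -> nat) -> R) :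
  (j <= m)%N -> (forall e : 'I_M -> nat, 0 <= h e) ->
  \sum_(alpha : {ffun 'I_M -> 'I_j.+1} | P alpha) h (fun i => alpha i) <=
  \sum_(alpha : {ffun 'I_M -> 'I_m.+1}) h (fun i => alpha i).
Proof.
move=> jm h0; pose w (alpha : {ffun 'I_M -> 'I_j.+1}) : {ffun 'I_M -> 'I_m.+1} :=
  [ffun i => widen_ord (jm : (j.+1 <= m.+1)%N) (alpha i)].
have wi : injective w.
  move=> a b /ffunP E; apply/ffunP => i; have := E i; rewrite !ffunE => /(congr1 val) /= ?.
  exact: val_inj.
have -> : \sum_(alpha : {ffun 'I_M -> 'I_j.+1} | P alpha) h (fun i => alpha i) =
    \sum_(beta in [set w alpha | alpha in P]%SET) h (fun i => beta i).
  rewrite big_imset /=; last by move=> ? ? _ _; exact: wi.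
  by apply: eq_bigr => a _; congr h; apply: funext => i; rewrite ffunE.
by rewrite big_mkcond; apply: ler_sum => b _; case: ifP.
Qed.

Lemma wnorm_subst M (T : ('I_M -> nat) -> Cplx R) (g : 'I_M -> fps R) :
  wnorm (fps_subst T g) <= \sum_(alpha : {ffun 'I_M -> 'I_m.+1})
    cabs (T (fun i => alpha i)) * \prod_i wnorm (g i) ^+ alpha i.
Proof.
pose p (a : 'I_M -> nat) := \big[@fps_mul R/@fps_one R]_(i < M) fps_exp (g i) (a i).
apply: (@le_trans _ _ (\sum_(alpha : {ffun 'I_M -> 'I_m.+1})
    cabs (T (fun i => alpha i)) * wnorm (p (fun i => alpha i)))).
  rewrite /wnorm; under [leRHS]eq_bigr do rewrite mulr_sumr.
  rewrite [leRHS]exchange_big /=; apply: ler_sum => j _.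
  pose h (e : 'I_M -> nat) := cabs (T e) * (cabs (p e j) * x ^+ j).
  have h0 e : 0 <= h e by rewrite mulr_ge0 ?cabs_ge0 ?wnorm_term_ge0.
  have jm : (j <= m)%N by rewrite -ltnS.
  apply: le_trans (sum_ffun_widen (fun alpha => (\sum_i alpha i <= j)%N) jm h0).
  rewrite /fps_subst; apply: le_trans (ler_wpM2r _ (cabs_sum _ _ _)) _.
    exact: exprn_ge0.
  by rewrite mulr_suml ler_sum // => a _; rewrite /h cabsM mulrA.
apply: ler_sum => a _; rewrite ler_wpM2l ?cabs_ge0 //.
apply: le_trans (wnorm_prod _) _; apply: ler_prod => i _.
by rewrite wnorm_ge0 wnorm_exp.
Qed.

Lemma geometric_le (q : R) K : 0 <= q -> q < 1 -> \sum_(l < K) q ^+ l <= (1 - q)^-1.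
Proof.
move=> q0 q1; rewrite -[leRHS]mul1r ler_pdivlMr ?subr_gt0 // mulrC.
have := subrX1 q K; set S := \sum_(_ < _) _ => E.
have -> : (1 - q) * S = 1 - q ^+ K by rewrite -opprB mulNr -E opprB.
by rewrite gerBl exprn_ge0.
Qed.

(** Under Cauchy's estimates the radii cancel, and the sum over multi-exponents factors into
    truncated geometric series of ratios [q i]. *)
Lemma wnorm_subst_le M (T : ('I_M -> nat) -> Cplx R) (g : 'I_M -> fps R)
    (mu : R) (Rd q : 'I_M -> R) : 0 <= mu ->
  (forall i, 0 < Rd i) -> (forall i, 0 <= q i) -> (forall i, q i < 1) ->
  (forall alpha, cabs (T alpha) <= mu * \prod_i (Rd i)^-1 ^+ alpha i) ->
  (forall i, wnorm (g i) <= q i * Rd i) ->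
  wnorm (fps_subst T g) <= mu * \prod_i (1 - q i)^-1.
Proof.
move=> mu0 Rd0 q0 q1 hT hg; apply: le_trans (wnorm_subst _ _) _.
apply: (@le_trans _ _ (\sum_(alpha : {ffun 'I_M -> 'I_m.+1})
   mu * \prod_i q i ^+ alpha i)).
  apply: ler_sum => a _.
  apply: (@le_trans _ _ ((mu * \prod_i (Rd i)^-1 ^+ a i) *
      \prod_i (q i * Rd i) ^+ a i)).
    rewrite ler_pM ?cabs_ge0 ?hT ?prodr_ge0 //.
      by move=> i _; rewrite exprn_ge0 ?wnorm_ge0.
    apply: ler_prod => i _; rewrite exprn_ge0 ?wnorm_ge0 //=.
    by rewrite lerXn2r ?nnegrE ?wnorm_ge0 ?mulr_ge0 // ltW.
  rewrite -mulrA -big_split /= le_eqVlt; apply/orP; left; apply/eqP; congr (_ * _).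
  apply: eq_bigr => i _; rewrite -exprMn mulrC mulfK //.
  by rewrite gt_eqF.
rewrite -mulr_sumr ler_wpM2l // -(bigA_distr_bigA (fun i (l : 'I_m.+1) => q i ^+ l)).
apply: ler_prod => i _; rewrite geometric_le // andbT.
by apply: sumr_ge0 => l _; rewrite exprn_ge0.
Qed.

End WeightedNorm.

(** * Coefficients of the operators in the equation *)

Section PowerSeriesOperators.
Variable R : realType.
Implicit Types a : fps R.

Lemma fps_X_mul0 a : fps_mul (@fps_X R) a 0%N = 0.
Proof. by rewrite /fps_mul big_ord1 mul0r. Qed.

Lemma fps_X_mulS a j : fps_mul (@fps_X R) a j.+1 = a j.
Proof.
rewrite /fps_mul 2!big_ord_recl big1 ?addr0; last by move=> i _; rewrite mul0r.
by rewrite mul0r add0r mul1r subn1.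
Qed.

Lemma fps_diffopE (L : {poly Cplx R}) k a j :
  fps_diffop L k a j = L.[(j + k)%:R] * a j.
Proof.
have E i : iter i (fps_delta_add k) a j = (j + k)%:R ^+ i * a j.
  elim: i => [|i IH]; first by rewrite mul1r.
  by rewrite iterS /fps_delta_add /fps_delta IH natrD exprS; ring.
rewrite /fps_diffop horner_coef mulr_suml; apply: eq_bigr => i _.
by rewrite E mulrA.
Qed.

Lemma iter_deltaE l a j : iter l (@fps_delta R) a j = j%:R ^+ l * a j.
Proof.
elim: l => [|l IH]; first by rewrite mul1r.
by rewrite iterS /fps_delta IH exprS mulrA.
Qed.

(** The gain of one degree drives the induction in [jet_norm_le]. *)
Lemma wnorm_X_mul (x : R) m a : 
  wnorm x m.+1 (fps_mul (@fps_X R) a) = x * wnorm x m a.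
Proof.
rewrite /wnorm big_ord_recl fps_X_mul0 cabs0 mul0r add0r mulr_sumr.
by apply: eq_bigr => j _; rewrite lift0 fps_X_mulS exprS; ring.
Qed.

End PowerSeriesOperators.

(** * Positivity of sigma *)

Section PolynomialGrowth.
Variable R : realType.

Lemma positive_lower_bound (u : nat -> R) (J : nat) :
  (forall j, (1 <= j)%N -> 0 < u j) ->
  exists2 c : R, 0 < c & forall j, (1 <= j < J)%N -> c <= u j.
Proof.
move=> u0; elim: J => [|J [c c0 IH]]; first by exists 1 => // j; rewrite ltn0 andbF.
have [->|J0] := posnP J.
  by exists 1 => // -[|j] /=; rewrite ?ltnS ?ltn0 ?andbF.
exists (Num.min c (u J)); first by rewrite lt_min c0 u0.
move=> j /andP[j1]; rewrite ltnS leq_eqVlt => /orP[/eqP->|jJ].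
  by rewrite ge_min lexx orbT.
by rewrite ge_min IH // j1.
Qed.

(** The leading term dominates for large j; the finitely many remaining quotients are positive
    because L(j + k) does not vanish. *)
Lemma poly_growth (L : {poly Cplx R}) (n k : nat) : (1 <= n)%N -> size L = n.+1 ->
  (forall j : nat, (1 <= j)%N -> L.[(j + k)%:R] != 0) ->
  exists2 c : R, 0 < c & forall j, (1 <= j)%N ->
    c <= cabs L.[(j + k)%:R] / j%:R ^+ n.
Proof.
move=> n1 hL hLk.
have [n' En] : exists n', n = n'.+1 by exists n.-1; rewrite prednK.
pose b := cabs L`_n; pose A := \sum_(i < n) cabs L`_i.
have b0 : 0 < b.
  by rewrite cabs_gt0 -[n]/(n.+1.-1) -hL -lead_coefE lead_coef_eq0 -size_poly_eq0 hL.
have A0 : 0 <= A by apply: sumr_ge0 => i _; exact: cabs_ge0.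
(* For j >= J and t = j + k this gives 2 A <= b t, so the lower-order terms, at most A t^(n-1), are
   at most half of b t^n. *)
pose J := (Num.trunc (2 * A / b)).+1.
pose u (j : nat) := cabs L.[(j + k)%:R] / j%:R ^+ n.
have u0 j : (1 <= j)%N -> 0 < u j.
  by move=> j1; rewrite divr_gt0 ?cabs_gt0 ?hLk // exprn_gt0 // ltr0n.
have [c c0 hc] := positive_lower_bound J u0.
exists (Num.min c (b / 2)); first by rewrite lt_min c0 divr_gt0.
move=> j j1; have [jJ|Jj] := ltnP j J; first by rewrite ge_min hc ?j1.
rewrite ge_min; apply/orP; right; rewrite ler_pdivlMr ?exprn_gt0 ?ltr0n //.
pose t : R := (j + k)%:R.
have t1 : 1 <= t by rewrite ler1n; lia.
have tA : 2 * A <= b * t.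
  rewrite [b * t]mulrC -ler_pdivrMr //; apply: (le_trans (ltW (truncnS_gt _))).
  by rewrite ler_nat (leq_trans Jj) // leq_addr.
have cabst : cabs ((j + k)%:R : Cplx R) = t by rewrite cabs_nat.
have jt : j%:R ^+ n <= t ^+ n by rewrite lerXn2r ?nnegrE ?ler0n // ler_nat leq_addr.
apply: (@le_trans _ _ (b / 2 * t ^+ n)).
  by rewrite ler_wpM2l // divr_ge0 // ltW.
rewrite horner_coef hL big_ord_recr /= addrC.
apply: le_trans (_ : _ <= b * t ^+ n - A * t ^+ n') _; last first.
  apply: le_trans (_ : _ <= cabs (L`_n * (j + k)%:R ^+ n) -
    cabs (- \sum_(i < n) L`_i * (j + k)%:R ^+ i)) _; last first.
    by apply: le_trans (cabs_sub_ge _ _) _; rewrite opprK.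
  rewrite cabsM cabsX cabst lerD2l lerN2 cabsN; apply: le_trans (cabs_sum _ _ _) _.
  rewrite mulr_suml; apply: ler_sum => i _; rewrite cabsM cabsX cabst.
  rewrite ler_wpM2l ?cabs_ge0 // ler_weXn2l // -ltnS -En; exact: ltn_ord.
rewrite En [t ^+ n'.+1]exprS.
have T0 : 0 <= t ^+ n' by rewrite exprn_ge0 // (le_trans ler01).
have : 2 * A * t ^+ n' <= b * t * t ^+ n' by rewrite ler_wpM2r.
by lra.
Qed.

End PolynomialGrowth.

(** * The majorant induction *)

Section Majorant.
Variables (R : realType) (n : nat) (psi : fps R) (T : ('I_n.+2 -> nat) -> Cplx R).
Variables (r rho mu sigma x : R) (Lc : nat -> Cplx R).
Hypotheses (r0 : 0 < r) (rho0 : 0 < rho) (mu0 : 0 <= mu) (sigma0 : 0 < sigma).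

Definition radii (i : 'I_n.+2) : R := if i == ord0 then r else rho.

Hypothesis Tle : forall alpha, cabs (T alpha) <= mu * \prod_i (radii i)^-1 ^+ alpha i.
Hypothesis psi0 : psi 0%N = 0.
Hypothesis Lc_ge : forall j, (1 <= j)%N -> sigma * j%:R ^+ n <= cabs (Lc j).
Hypothesis psiE : forall j,
  Lc j * psi j = fps_mul (@fps_X R) (fps_subst T (@jet R n psi)) j.
Hypotheses (x0 : 0 <= x) (xr : x < r).
Hypothesis x_small :
  x * mu <= sigma * (n.+1%:R ^+ n.+1 / n.+2%:R ^+ n.+2) * rho * (1 - x / r).

Definition jet_norm m : R := \sum_(j < m.+1) j%:R ^+ n * cabs (psi j) * x ^+ j.

(** j^l <= j^n needs j >= 1; the term j = 0, where 0^0 = 1 matters, is removed by [psi0]. *)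
Lemma wnorm_iter_delta l m : (l <= n)%N ->
  wnorm x m (iter l (@fps_delta R) psi) <= jet_norm m.
Proof.
move=> ln; apply: ler_sum => -[[|j] hj] _ /=.
  by rewrite iter_deltaE psi0 mulr0 cabs0 mulr0 mul0r.
rewrite iter_deltaE cabsM cabsX cabs_nat ler_wpM2r ?exprn_ge0 //.
by rewrite ler_wpM2r ?cabs_ge0 // ler_weXn2l // ler1n.
Qed.

(* u = 1/(n+2) maximises u (1 - u)^(n+1), with maximum N: this is where the
   constants N and rho / (n+2) come from. *)
Lemma jet_norm_le m : jet_norm m <= rho / n.+2%:R.
Proof.
have rn0 : 0 <= rho / n.+2%:R by rewrite divr_ge0 // ltW.
elim: m => [|m IH].
  by rewrite /jet_norm big_ord1 psi0 cabs0 mulr0 mul0r.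
have N2 : n.+2%:R != 0 :> R by rewrite pnatr_eq0.
have N1 : n.+1%:R != 0 :> R by rewrite pnatr_eq0.
(* Ratio of norm bound to radius: x against r for the variable z, and the inductive bound rho / (n +
   2) against rho for each delta^l psi. *)
pose q (i : 'I_n.+2) : R := if i == ord0 then x / r else n.+2%:R^-1.
have q0 i : 0 <= q i by rewrite /q; case: ifP => _; rewrite ?divr_ge0 ?invr_ge0 // ltW.
have q1 i : q i < 1.
  rewrite /q; case: ifP => _; first by rewrite ltr_pdivrMr // mul1r.
  by rewrite invf_lt1 // ltr1n.
have Rd0 i : 0 < radii i by rewrite /radii; case: ifP.
have hg (i : 'I_n.+2) : wnorm x m (@jet R n psi i) <= q i * radii i.
  have [->|[l ->]] : i = ord0 \/ exists l : 'I_n.+1, i = lift ord0 l.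
    by case: (unliftP ord0 i) => [l ->|->]; [right; exists l|left].
    rewrite /q /radii eqxx divfK ?gt_eqF // /wnorm /jet /= /fps_X.
    have [->|m1] := posnP m; first by rewrite big_ord1 cabs0 mul0r.
    case: m m1 {IH} => // m _; rewrite 2!big_ord_recl big1 => [|j _].
      by rewrite cabs0 mul0r add0r addr0 cabs1 mul1r.
    by rewrite cabs0 mul0r.
  rewrite /q /radii /= mulrC; apply: le_trans IH.
  by apply: wnorm_iter_delta; rewrite -ltnS.
have := wnorm_subst_le x0 mu0 Rd0 q0 q1 Tle hg.
rewrite big_ord_recl /q /=; set P := \prod_(_ < _) _ => hs.
have PE : P = (n.+2%:R / n.+1%:R) ^+ n.+1.
  rewrite /P prodr_const card_ord; congr (_ ^+ _).
  have -> : 1 - n.+2%:R^-1 = n.+1%:R / n.+2%:R :> R.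
    apply: (mulIf N2); rewrite mulrBl mul1r mulVf // divfK //.
    by rewrite -[n.+2%:R]natr1 addrK.
  by rewrite invf_div.
rewrite -(ler_pM2l sigma0).
apply: (@le_trans _ _ (x * (mu * ((1 - x / r)^-1 * P)))).
  (* Degree by degree, sigma j^n |c_j| is at most the modulus of the coefficient of z M; the factor
     z lowers the truncation from m + 1 to m, where the induction hypothesis applies. *)
  apply: (@le_trans _ _ (x * wnorm x m (fps_subst T (@jet R n psi)))); last first.
    by rewrite ler_wpM2l.
  rewrite -wnorm_X_mul /jet_norm /wnorm mulr_sumr; apply: ler_sum => -[[|j] hj] _ /=.
    by rewrite psi0 cabs0 mulr0 !mul0r mulr0 mulr_ge0 ?cabs_ge0.
  rewrite -psiE cabsM !mulrA ler_wpM2r ?exprn_ge0 // ler_wpM2r ?cabs_ge0 //.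
  exact: Lc_ge.
have d0 : 0 < 1 - x / r by rewrite subr_gt0 ltr_pdivrMr // mul1r.
rewrite mulrA [_^-1 * P]mulrC mulrA ler_pdivrMr // PE.
(* [x_small] enters here. Since N P = 1 / (n + 2), the rest is an equality. *)
apply: (@le_trans _ _ (sigma * (n.+1%:R ^+ n.+1 / n.+2%:R ^+ n.+2) * rho *
    (1 - x / r) * (n.+2%:R / n.+1%:R) ^+ n.+1)).
  by rewrite ler_wpM2r // exprn_ge0 // divr_ge0.
rewrite le_eqVlt; apply/orP; left; apply/eqP.
rewrite expr_div_n [n.+2%:R ^+ n.+2]exprS.
set v : R := n.+2%:R; set a := n.+1%:R ^+ n.+1; set b := v ^+ n.+1; set d := 1 - _.
have a0 : a != 0 by rewrite expf_neq0.
have b0 : b != 0 by rewrite expf_neq0.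
by field; rewrite a0 b0 -natrD pnatr_eq0.
Qed.

(** By the case l = 0 of [wnorm_iter_delta], the absolute partial sums stay below rho / (n + 2). *)
Lemma majorant_cvg (z : Cplx R) : cabs z = x ->
  cvgn (series (fun j => psi j * z ^+ j)).
Proof.
move=> zx; apply: (@cvgn_series_abs _ _ (rho / n.+2%:R)) => -[|m].
  by rewrite big_geq // divr_ge0 // ltW.
rewrite big_mkord; apply: le_trans (jet_norm_le m).
apply: le_trans (@wnorm_iter_delta 0 m _) => //.
by apply: ler_sum => j _; rewrite cabsM cabsX zx.
Qed.

End Majorant.

(** * Convergence in the disk of radius R *)

Lemma polydisk_radii (R : realType) (n : nat) (r rho : R) :
  @polydisk R n r rho =
  [set x : 'rV[Cplx R]_n.+2 | forall j, cabs (x 0 j) <= radii r rho j].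
Proof.
apply/seteqP; split=> x /=; rewrite /polydisk /radii /=.
  by move=> [h0 h] j; case: (unliftP ord0 j) => [l ->|->] /=; rewrite ?h ?eqxx.
move=> h; split; first by have := h ord0; rewrite eqxx.
by move=> l; have := h (lift ord0 l).
Qed.

Theorem proposition1 (R : realType) (n k : nat) (L : {poly Cplx R})
  (M : 'rV[Cplx R]_n.+2 -> Cplx R) (r rho mu : R) (psi : fps R)
  (hn : (1 <= n)%N) (hk : (1 <= k)%N)
  (hL : size L = n.+1)
  (hLk : forall j : nat, (1 <= j)%N -> L.[(j + k)%:R] != 0)
  (hr : 0 < r) (hrho : 0 < rho)
  (hM : holomorphic_near (polydisk r rho) M)
  (hmu : is_max_on (polydisk r rho) (fun x => cabs (M x)) mu)
  (hpsi0 : psi 0%N = 0)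
  (hpsi : fps_diffop L k psi =
          fps_mul (@fps_X R) (fps_subst (taylor_coef M) (@jet R n psi))) :
  let sigma : R :=
    inf [set cabs L.[(j + k)%:R] / j%:R ^+ n | j in [set j : nat | (1 <= j)%N]] in
  let N : R := n.+1%:R ^+ n.+1 / n.+2%:R ^+ n.+2 in
  let Rad : R := r * (rho / (rho + mu * r / (sigma * N))) in
  0 < sigma /\
  forall z : Cplx R, cabs z < Rad -> cvgn (series (fun j : nat => psi j * z ^+ j)).
Proof.
move=> sigma N Rad.
have [c c0 hc] := poly_growth hn hL hLk.
have lbc : lbound [set cabs L.[(j + k)%:R] / j%:R ^+ n |
    j in [set j : nat | (1 <= j)%N]] c by move=> _ [j j1 <-]; exact: hc.
have sigma0 : 0 < sigma.
  apply: lt_le_trans c0 _; apply: lb_le_inf => //.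
  by eexists; exists 1%N.
split=> // z hz.
have sigma_le j : (1 <= j)%N -> sigma * j%:R ^+ n <= cabs L.[(j + k)%:R].
  move=> j1; rewrite -ler_pdivlMr ?exprn_gt0 ?ltr0n //.
  by apply: ge_inf; [exists c|exists j].
have [[w _ muE] hmax] := hmu.
have mu0 : 0 <= mu by rewrite -muE cabs_ge0.
rewrite polydisk_radii in hM hmax.
have N0 : 0 < N by rewrite divr_gt0 ?exprn_gt0 ?ltr0n.
have sN : 0 < sigma * N by rewrite mulr_gt0.
have f0 : 0 <= mu * r / (sigma * N).
  by apply: divr_ge0; [apply: mulr_ge0 => //|]; exact: ltW.
have den : 0 < rho + mu * r / (sigma * N) by rewrite ltr_pwDl.
have x0 := cabs_ge0 z.
have key : cabs z * (rho + mu * r / (sigma * N)) < r * rho.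
  by move: hz; rewrite /Rad mulrA ltr_pdivlMr.
have xr : cabs z < r.
  rewrite -(ltr_pM2r hrho); apply: le_lt_trans key.
  by rewrite ler_wpM2l // lerDl.
apply: (@majorant_cvg R n psi (taylor_coef M) r rho mu sigma (cabs z)
  (fun j => L.[(j + k)%:R])) => //.
- move=> alpha; apply: taylor_coef_le => // i; rewrite /radii.
  by case: ifP.
- by move=> j; rewrite -fps_diffopE hpsi.
(* What remains is [x_small], a rearrangement of [key]: |z| mu r / (sigma N) <= rho (r - |z|). *)
rewrite -/N.
have -> : sigma * N * rho * (1 - cabs z / r) = sigma * N * (rho * (r - cabs z)) / r.
  by field; rewrite gt_eqF.
rewrite ler_pdivlMr //.
have -> : cabs z * mu * r =
    sigma * N * (cabs z * (mu * r / (sigma * N))).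
  by field; rewrite !gt_eqF.
rewrite ler_pM2l //; move: key; lra.
Qed.
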